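(* Let $X=\mathbb{R}^n$, let $C\subset X$ be compact and convex, let $U\subset\mathbb{R}^d$ be compact, and let $T>0$, $K>0$. Let $g\colon[0,T]\times X\times U\to X$ be measurable with respect to $t$, continuous with respect to $(x,u)$ and uniformly bounded. Let $f\colon[0,T]\times X^2\times U\to\mathbb{R}$ be measurable with respect to $t\in[0,T]$ and upper semicontinuous with respect to $(x,\dot x,u)\in X\times X\times U$. Set $$\mathscr{U}_K:=\{u\in L^1(0,T;\mathbb{R}^d): u(t)\in U\text{ for a.e. }t\text{ and } TV(u)\le K\}.$$ Consider the problem $$\begin{cases}\dot x(t)\in-\mathcal{N}_C(x(t))+g(t,x(t),u(t))\ \text{ for a.e. } t\in[0,T],\\ u(t)\in U\ \text{ for a.e. }t\in[0,T],\quad \int_0^T u(t)\,dt=0,\\ x(0)=x(T),\end{cases}\qquad(\ast)$$ and assume that $(\ast)$ admits solutions $(x,u)$ with $u\in\mathscr{U}_K$. Then the integral functional $$\mathscr{I}(x,u):=\int_0^T f(t,x(t),\dot x(t),u(t))\,dt$$ admits a maximizer among all processes $(x,u)$ of $(\ast)$ such that $u\in\mathscr{U}_K$.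
   Context: $X=\mathbb{R}^n$ is a Euclidean space. For a closed convex set $C\subset X$ and $x\in C$, $\mathcal{N}_C(x)=\{v\in X:\langle v,y-x\rangle\le0\ \forall y\in C\}$ is the normal cone of convex analysis; for $x\notin C$, $\mathcal{N}_C(x)=\emptyset$ (so a solution satisfies $x(t)\in C$). $TV(u)$ denotes the total variation on $[0,T]$ of the function $u$. A process (state-control pair) of $(\ast)$ is a pair $(x,u)$ with $u$ a measurable control and $x\colon[0,T]\to X$ an absolutely continuous solution of the differential inclusion corresponding to $u$, such that all the conditions in $(\ast)$ hold.
   Formalization: Added assumption: along all competing processes, t ↦ f(t,x(t),ẋ(t),u(t)) is measurable and bounded above a.e. by one common integrable function of t; without such an upper bound the supremum may fail to be attained. *)

(* Defs.v *)
From HB Require Import structures.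
From mathcomp Require Import all_boot all_order all_algebra.
From mathcomp Require Import all_classical all_reals all_analysis.

Set Implicit Arguments.
Unset Strict Implicit.
Unset Printing Implicit Defensive.
Import Order.TTheory GRing.Theory Num.Theory.
Import numFieldNormedType.Exports.

Local Open Scope classical_set_scope.
Local Open Scope ring_scope.

(* [lebesgue_measure] lives on the Borel sigma-algebra.  Measurability in time,
   "a.e." and integrals refer to the completed (Lebesgue) sigma-algebra, which
   is carried by this alias of [R]. *)
Notation lebT R := (caratheodory_type (@wlength R idfun)^*%mu).
Notation leb R := (@completed_lebesgue_measure R).

(* The library norm of ['rV[R]_n] is the max norm; it induces the topology, but
   the normal cone and the variation are Euclidean. *)
Definition dot (R : realType) (n : nat) (v w : 'rV[R]_n) : R :=
  \sum_(i < n) v ord0 i * w ord0 i.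

Definition enorm (R : realType) (n : nat) (v : 'rV[R]_n) : R :=
  Num.sqrt (dot v v).

(* Empty when [x] is not in [C]. *)
Definition normal_cone (R : realType) (n : nat) (C : set 'rV[R]_n)
    (x : 'rV[R]_n) : set 'rV[R]_n :=
  [set v | C x /\ forall y, C y -> dot v (y - x) <= 0].

(* Functions of time are total on [R]; only their values on [0, T] matter. *)
Definition measurable_on (R : realType) (T : R) (n : nat)
    (h : R -> 'rV[R]_n) : Prop :=
  forall i : 'I_n,
    measurable_fun (`[0, T] : set (lebT R)) (fun t : lebT R => h t ord0 i).

Definition integrable_on (R : realType) (T : R) (n : nat)
    (h : R -> 'rV[R]_n) : Prop :=
  forall i : 'I_n,
    (leb R).-integrable (`[0, T] : set (lebT R))
      (fun t : lebT R => (h t ord0 i)%:E).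

Definition absolutely_continuous_on (R : realType) (T : R) (n : nat)
    (x : R -> 'rV[R]_n) : Prop :=
  forall e : R, 0 < e -> exists2 del : R, 0 < del &
    forall (m : nat) (a b : 'I_m -> R),
      (forall i, [/\ 0 <= a i, a i <= b i & b i <= T]) ->
      (forall i j, i != j -> b i <= a j \/ b j <= a i) ->
      \sum_(i < m) (b i - a i) < del ->
      \sum_(i < m) enorm (x (b i) - x (a i)) < e.

(* Vector-valued, Euclidean counterpart of the library's [total_variation],
   which is restricted to real-valued functions. *)
Definition evariation (R : realType) (n : nat) (a b : R) (u : R -> 'rV[R]_n)
    (s : seq R) : R :=
  let F := u \o nth b (a :: s) in
  \sum_(0 <= k < size s) enorm (F k.+1 - F k).

Definition etotal_variation (R : realType) (n : nat) (a b : R)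
    (u : R -> 'rV[R]_n) : \bar R :=
  ereal_sup [set (evariation a b u s)%:E | s in itv_partition a b].

Definition upper_semicontinuous_on (R : realType) (X : topologicalType)
    (A : set X) (h : X -> R) : Prop :=
  forall p, A p -> forall a : R, h p < a ->
    \forall q \near within A (nbhs p), h q < a.

Definition controls (R : realType) (d : nat) (U : set 'rV[R]_d) (T K : R) :
    set (R -> 'rV[R]_d) :=
  [set u | [/\ integrable_on T u,
               \forall t \ae leb R, t \in `[0, T] -> U (u t)
             & (etotal_variation 0 T u <= K%:E)%E]].

Definition process (R : realType) (n d : nat) (C : set 'rV[R]_n)
    (U : set 'rV[R]_d) (T : R) (g : R -> 'rV[R]_n -> 'rV[R]_d -> 'rV[R]_n)
    (x : R -> 'rV[R]_n) (u : R -> 'rV[R]_d) : Prop :=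
  [/\ measurable_on T u /\ absolutely_continuous_on T x,
      \forall t \ae leb R, t \in `[0, T] ->
        derivable x t 1 /\
        exists2 v, normal_cone C (x t) v & derive1 x t = - v + g t (x t) (u t),
      \forall t \ae leb R, t \in `[0, T] -> U (u t),
      forall i : 'I_d, (\int[leb R]_(t in `[0%R, T]) (u t ord0 i)%:E = 0)%E
    & x 0 = x T].

Definition integrand (R : realType) (n d : nat)
    (f : R -> 'rV[R]_n -> 'rV[R]_n -> 'rV[R]_d -> R)
    (x : R -> 'rV[R]_n) (u : R -> 'rV[R]_d) (t : R) : R :=
  f t (x t) (derive1 x t) (u t).

Definition cost (R : realType) (n d : nat) (T : R)
    (f : R -> 'rV[R]_n -> 'rV[R]_n -> 'rV[R]_d -> R)
    (x : R -> 'rV[R]_n) (u : R -> 'rV[R]_d) : \bar R :=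
  (\int[leb R]_(t in `[0%R, T]) (integrand f x u t)%:E)%E.

(* The integral functional is well defined, with values in [-oo, +oo[, on the
   competing processes, with a common integrable upper bound.  Measurability of
   [f] in [t] and upper semicontinuity in the other variables do not give this:
   the superposition may fail to be measurable, and without an upper bound the
   supremum may fail to be attained.  For instance, with [T = 1], [g = 0],
   [C = [0, 1]], [U = {0}] the processes are the constants [x], and
   [f t x v u = k - 1] if [x = 1/k] and [0 < t <= 1/k] for some integer
   [k >= 1], [0] otherwise, gives the supremum [1], never attained.
   Both conditions hold, e.g., when [f] is bounded and jointly measurable. *)
Definition cost_well_defined (R : realType) (n d : nat) (C : set 'rV[R]_n)
    (U : set 'rV[R]_d) (T K : R) (g : R -> 'rV[R]_n -> 'rV[R]_d -> 'rV[R]_n)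
    (f : R -> 'rV[R]_n -> 'rV[R]_n -> 'rV[R]_d -> R) : Prop :=
  (forall x u, process C U T g x u -> controls U T K u ->
    measurable_fun (`[0, T] : set (lebT R))
      (integrand f x u : lebT R -> R)) /\
  exists2 m : R -> R,
    (leb R).-integrable (`[0, T] : set (lebT R)) (fun t : lebT R => (m t)%:E) &
    forall x u, process C U T g x u -> controls U T K u ->
      \forall t \ae leb R, t \in `[0, T] -> integrand f x u t <= m t.

(* Main.v *)
(* A velocity x' = - v + g with v normal to C at x is orthogonal to v,
   because s |-> <v, x s> is maximal at t; so |x'|^2 = <g, x'> and |x'| <= |g|, and
   all trajectories are M-Lipschitz.  Along a maximizing sequence (x_k, u_k), Helly's
   theorem gives u_k -> u a.e. and Arzela-Ascoli gives x_k -> x.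

   The inclusion is equivalent to <g_k - x_k', y - x_k> <= 0 for all y in C.  In its
   integral over an interval, x_k' converges weakly and everything else strongly, so
   the inequality passes to the limit; differentiating at Lebesgue points, (x, u) is
   a process.  Then int |x_k'|^2 = int <g_k, x_k'> converges to int <g, x'> =
   int |x'|^2, hence x_k' -> x' in L^2 and, for a subsequence, a.e.  Upper
   semicontinuity and the reverse Fatou lemma conclude. *)
Require Import Defs.
From HB Require Import structures.
From mathcomp Require Import all_boot all_order all_algebra.
From mathcomp Require Import all_classical all_reals all_analysis.
From mathcomp Require Import measurable_realfun.
From mathcomp Require Import ring lra.
Set Implicit Arguments.
Unset Strict Implicit.
Unset Printing Implicit Defensive.
Import Order.TTheory GRing.Theory Num.Theory.
Import numFieldNormedType.Exports.
Local Open Scope classical_set_scope.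
Local Open Scope ring_scope.

(** * Borel and Lebesgue measurability *)

(** The integrand is not assumed concave in the velocity, so weak convergence of the velocities
    would not carry the cost to the limit; the energy identity |x'|^2 = <g, x'> is what upgrades it
    to convergence almost everywhere. Nothing is convex in the control either: there the variation
    bound provides the convergence.

    Weak convergence of derivatives is proved by hand: a bounded test function is approximated by
    Lipschitz ones, and integration by parts moves the derivative onto them. This needs velocities
    represented by bounded functions, hence Lipschitz trajectories, whereas a process is only
    absolutely continuous with an almost everywhere bound on its derivative; a covering argument
    bridges this gap.

    Limits are first taken along an ultrafilter, which provides one at every time simultaneously.
    Inequalities between finitely many times, such as variation and Lipschitz bounds, then pass to
    the limit even at times where the extracted subsequence may diverge.

    Differentiation is done for the Borel measure and transported to its completion, where almost
    everywhere modifications remain measurable. *)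

#[local] Instance leb_ae_filter {R : realType} :
  Filter (almost_everywhere (leb R)) := ae_filter_ringOfSetsType (leb R).

Section borel_completion.
Context {R : realType}.
Implicit Types (A D : set R) (f : R -> R).

Lemma borel_lebT A : measurable A -> measurable (A : set (lebT R)).
Proof. by move=> mA; apply: sub_caratheodory. Qed.

Lemma borel_lebT_fun D f : measurable D -> measurable_fun D f ->
  measurable_fun (D : set (lebT R)) (f : lebT R -> R).
Proof. by move=> mD mf _ B mB; apply: borel_lebT; exact: mf. Qed.

Lemma ae_lebesgue_leb (P : R -> Prop) :
  (\forall t \ae @lebesgue_measure R, P t) -> \forall t \ae leb R, P t.
Proof.
by move=> [A [mA A0 PA]]; exists A; split=> //; exact: borel_lebT.
Qed.

(** The identity is measurable from the completed sigma-algebra to the Borel one and pushes [leb R]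
    forward to Lebesgue measure, so this is a change of variables. *)
Lemma ge0_integral_lebesgue_leb D f : measurable D -> measurable_fun D f ->
  (forall t, D t -> 0 <= f t) ->
  (\int[@lebesgue_measure R]_(t in D) (f t)%:E =
   \int[leb R]_(t in (D : set (lebT R))) (f t)%:E)%E.
Proof.
move=> mD mf f0.
have mid : measurable_fun [set: lebT R] (idfun : lebT R -> measurableTypeR R).
  by move=> _ B mB; rewrite setTI; exact: borel_lebT.
rewrite -[RHS](@ge0_integral_pushforward _ _ _ _ _ _ mid (leb R) D (EFin \o f) mD).
- by apply: (@eq_measure_integral _ _ _ _
    (measure_function_pushforward__canonical__measure_function_Measure (leb R)
      mid)).
- by apply/measurable_EFinP.
- by move=> t /set_mem Dt; rewrite lee_fin f0.
Qed.

Lemma Rintegral_lebesgue_leb D f : measurable D -> measurable_fun D f ->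
  \int[@lebesgue_measure R]_(t in D) f t =
  \int[leb R]_(t in (D : set (lebT R))) f t.
Proof.
move=> mD mf; rewrite /Rintegral; congr fine.
rewrite integralE [RHS]integralE.
have pE g (t : R) : ((fun x => (g x)%:E)^\+ t = (Num.max (g t) 0)%:E)%E.
  by rewrite funeposE EFin_max.
have nE g (t : R) : ((fun x => (g x)%:E)^\- t = (Num.max (- g t) 0)%:E)%E.
  by rewrite funenegE EFin_max.
congr (_ - _)%E.
  under eq_integral do rewrite pE.
  under [RHS]eq_integral do rewrite pE.
  apply: ge0_integral_lebesgue_leb => //.
    by apply: measurable_maxr => //; exact: measurable_cst.
  by move=> t _; rewrite le_max lexx orbT.
under eq_integral do rewrite nE.
under [RHS]eq_integral do rewrite nE.
apply: ge0_integral_lebesgue_leb => //.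
  apply: measurable_maxr; last exact: measurable_cst.
  exact: measurableT_comp.
by move=> t _; rewrite le_max lexx orbT.
Qed.

(** Each superlevel set at a rational threshold is Borel off a Borel null set. A null Borel set [M]
    contains these countably many exceptional sets, and [f] is replaced by 0 on it. The pointwise
    clause lets [q] inherit bounds and supports from [f]. *)
Lemma lebT_borel_ae f : measurable_fun [set: lebT R] (f : lebT R -> R) ->
  exists2 q : R -> R, measurable_fun [set: R] q &
    (\forall t \ae leb R, f t = q t) /\ forall t, q t = f t \/ q t = 0.
Proof.
move=> mf.
pose r_ (k : nat) : R := ratr (odflt 0 (unpickle k)).
have mE (k : nat) : exists N : set R, [/\ measurable N,
    @lebesgue_measure R N = 0%E & measurable ([set t | r_ k < f t] `\` N)].
  have : measurable ([set t : lebT R | r_ k < f t]).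
    have := mf measurableT `]r_ k, +oo[%classic (measurable_itv _).
    rewrite setTI; congr measurable; apply/seteqP; split => t /=;
      by rewrite in_itv/= andbT.
  (* A set of the completion is a Borel set [A] together with a part of a Borel null set [M], so the
     two agree off [M]. *)
  rewrite -completed_caratheodory_measurable g_sigma_completed_algebra_genE.
  move=> [A /= mA [N [M [mM M0 NM]] AN]].
  exists M; split => //.
  have -> : [set t | r_ k < f t] `\` M = A `\` M.
    rewrite -AN; apply/seteqP; split => t /=.
      by move=> [[|/NM] //].
    by move=> [At Mt]; split => //; left.
  exact: measurableD.
have [N /all_and3[mN N0 mEN]] := choice mE.
have [M [mM M0 NM]] : (@lebesgue_measure R).-negligible (\bigcup_k N k).
  apply: (@negligible_bigcup _ (measurableTypeR R) _ (@lebesgue_measure R)).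
  by move=> k; exists (N k); split; [exact: mN|exact: N0|].
exists (fun t => if t \in M then 0 else f t); last split.
- move=> _; apply: (measurability _ (RGenOInfty.measurableE R)) => //.
  move=> _ [_ [x ->] <-]; rewrite setTI.
  (* An open ray is reached through rational thresholds; the last set accounts for the value 0 on
     [M]. *)
  have -> : (fun t => if t \in M then 0 else f t) @^-1` `]x, +oo[%classic =
      \bigcup_k [set t | x < r_ k /\ ([set t | r_ k < f t] `\` M) t] `|`
      [set t | M t /\ x < 0].
    apply/seteqP; split => t /=; rewrite in_itv/= andbT.
      case: ifPn => [/set_mem Mt x0|/negP Mt xf]; first by right.
      left; have [q xq] := rat_in_itvoo xf.
      move: xq; rewrite in_itv/= => /andP[xq qf].
      exists (pickle q) => //=; rewrite /r_ pickleK /=; split => //; split => //.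
      by move=> /mem_set.
    move=> [[k _ /= [xr [rf Mt]]]|[Mt x0]]; last by rewrite mem_set.
    by rewrite memNset// (lt_trans xr).
  apply: measurableU; last first.
    have [x0|x0] := ltP x 0.
      by rewrite (_ : [set _ | _] = M)//; apply/seteqP; split => t //= [].
    by rewrite (_ : [set _ | _] = set0)//; apply/seteqP; split => t //= [].
  apply: bigcupT_measurable => k; have [x0|x0] := ltP x (r_ k); last first.
    by rewrite (_ : [set _ | _] = set0)//; apply/seteqP; split => t //= [].
  rewrite (_ : [set _ | _] = ([set t | r_ k < f t] `\` N k) `\` M).
    exact: measurableD.
  apply/seteqP; split => t //=.
    by move=> [_ [rf Mt]]; split => //; split => // Nt; apply/Mt/NM; exists k.
  by move=> [[rf _] Mt].
- apply: ae_lebesgue_leb; exists M; split=> //= t /=; apply: contra_notP.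
  by move=> Mt; rewrite memNset.
- by move=> t; case: ifP => _; [right|left].
Qed.

End borel_completion.

(** * Bounded measurable functions on a compact interval *)

Section bounded_measurable.
Context {R : realType}.
Implicit Types (a b t : R) (f g h : R -> R).

(** This class is stable under sums, products and restriction, and it suffices for integrability on
    a compact interval, so integrability never has to be carried through a computation. The bound is
    asked at every point of the interval, not almost everywhere. *)
Definition bounded_measurable a b h : Prop :=
  measurable_fun (`[a, b] : set (lebT R)) (h : lebT R -> R) /\
  exists M, forall t, t \in `[a, b] -> `|h t| <= M.

Lemma measurable_lebT_itv (i : interval R) : measurable ([set` i] : set (lebT R)).
Proof. by apply: borel_lebT; exact: measurable_itv. Qed.
#[local] Hint Resolve measurable_lebT_itv : core.

Lemma leb_itvcc a b : a <= b -> leb R `[a, b]%classic = (b - a)%:E.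
Proof.
move=> ab; transitivity (@lebesgue_measure R `[a, b]%classic) => //.
rewrite lebesgue_measure_itv/= lte_fin; case: ltP => [//|ba].
by rewrite (le_anti _ : a = b) ?subrr// ab ba.
Qed.

Lemma leb_itvcc_fin a b : (leb R `[a, b]%classic < +oo)%E.
Proof.
have [ab|ba] := leP a b; first by rewrite leb_itvcc// ltry.
by rewrite set_itv_ge ?measure0// bnd_simp -ltNge.
Qed.

Lemma bounded_measurable_integrable a b h : bounded_measurable a b h ->
  (leb R).-integrable (`[a, b] : set (lebT R)) (EFin \o h).
Proof.
move=> [mh [M hM]]; apply: measurable_bounded_integrable => //.
  exact: leb_itvcc_fin.
by exists M; split; [exact: num_real|move=> x Mx t tab /=;
  apply: (le_trans (hM t tab)); exact: ltW].
Qed.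

Lemma bounded_measurableS a b c d h : a <= c -> d <= b ->
  bounded_measurable a b h -> bounded_measurable c d h.
Proof.
move=> ac db [mh [M hM]].
have cdab t : t \in `[c, d] -> t \in `[a, b] by apply/subitvP;
  rewrite subitvE !bnd_simp ac db.
split; last by exists M => t /cdab; exact: hM.
exact: measurable_funS mh.
Qed.

Lemma bounded_measurable_cst a b (r : R) : bounded_measurable a b (fun=> r).
Proof. by split; [exact: measurable_cst|exists `|r|]. Qed.

Lemma bounded_measurableD a b f g : bounded_measurable a b f ->
  bounded_measurable a b g -> bounded_measurable a b (fun t => f t + g t).
Proof.
move=> [mf [M fM]] [mg [N gN]]; split; first exact: measurable_funD.
exists (M + N) => t tab; apply: (le_trans (ler_normD _ _)).
by apply: lerD; [exact: fM|exact: gN].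
Qed.

Lemma bounded_measurableM a b f g : bounded_measurable a b f ->
  bounded_measurable a b g -> bounded_measurable a b (fun t => f t * g t).
Proof.
move=> [mf [M fM]] [mg [N gN]]; split; first exact: measurable_funM.
exists (M * N) => t tab; rewrite normrM.
by apply: ler_pM => //; [exact: fM|exact: gN].
Qed.

Lemma bounded_measurableN a b f : bounded_measurable a b f ->
  bounded_measurable a b (fun t => - f t).
Proof.
move=> [mf [M fM]]; split; first exact: measurableT_comp.
by exists M => t tab; rewrite normrN fM.
Qed.

Lemma bounded_measurableB a b f g : bounded_measurable a b f ->
  bounded_measurable a b g -> bounded_measurable a b (fun t => f t - g t).
Proof.
by move=> bf bg; exact: (bounded_measurableD bf (bounded_measurableN bg)).
Qed.

Lemma bounded_measurable_norm a b f : bounded_measurable a b f ->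
  bounded_measurable a b (fun t => `|f t|).
Proof.
move=> [mf [M fM]]; split; first exact: measurableT_comp.
by exists M => t tab; rewrite normr_id fM.
Qed.

Lemma bounded_measurable_sum a b (I : Type) (s : seq I) (F : I -> R -> R) :
  (forall i, bounded_measurable a b (F i)) ->
  bounded_measurable a b (fun t => \sum_(i <- s) F i t).
Proof.
move=> bF; elim: s => [|i s IH].
  have -> : (fun t => \sum_(i <- [::]) F i t) = (fun=> 0).
    by apply/funext => t; rewrite big_nil.
  exact: bounded_measurable_cst.
have -> : (fun t => \sum_(i <- i :: s) F i t) = (fun t => F i t + \sum_(j <- s)
  F j t).
  by apply/funext => t; rewrite big_cons.
exact: bounded_measurableD.
Qed.

Lemma lebT_continuous_measurable a b h : continuous h ->
  measurable_fun (`[a, b] : set (lebT R)) (h : lebT R -> R).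
Proof.
move=> ch; apply: borel_lebT_fun; first exact: measurable_itv.
by apply: measurable_funTS; exact: continuous_measurable_fun.
Qed.

Lemma Rintegral_ae_eq a b f g :
  measurable_fun (`[a, b] : set (lebT R)) (f : lebT R -> R) ->
  measurable_fun (`[a, b] : set (lebT R)) (g : lebT R -> R) ->
  (\forall t \ae leb R, t \in `[a, b] -> f t = g t) ->
  \int[leb R]_(t in `[a, b]) f t = \int[leb R]_(t in `[a, b]) g t.
Proof.
move=> mf mg fg; rewrite /Rintegral; congr fine.
apply: (@ae_eq_integral _ _ _ (leb R) _ (EFin \o g) (EFin \o f)
  (measurable_lebT_itv _)); [exact/measurable_EFinP..|].
by apply: filterS fg => t fg tab; rewrite /= fg.
Qed.

Lemma lebT_ae_measurable a b f g :
  (\forall t \ae leb R, t \in `[a, b] -> f t = g t) ->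
  measurable_fun (`[a, b] : set (lebT R)) (f : lebT R -> R) ->
  measurable_fun (`[a, b] : set (lebT R)) (g : lebT R -> R).
Proof.
move=> fg /measurable_EFinP mf; apply/measurable_EFinP.
apply: (ae_measurable_fun completed_lebesgue_measure_is_complete _ mf).
by apply: filterS fg => t fg tab /=; rewrite fg.
Qed.

(** [f] is traded for the minimum of [f] and [g], which agrees with it almost everywhere and lies
    below [g] at every point. *)
Lemma Rintegral_ae_le a b f g : bounded_measurable a b f ->
  bounded_measurable a b g ->
  (\forall t \ae leb R, t \in `[a, b] -> f t <= g t) ->
  \int[leb R]_(t in `[a, b]) f t <= \int[leb R]_(t in `[a, b]) g t.
Proof.
move=> bf bg fg.
have bmin : measurable_fun (`[a, b] : set (lebT R)) (fun t : lebT R => Num.min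
  (f t) (g t)).
  by apply: measurable_minr; [case: bf|case: bg].
have fE : (\forall t \ae leb R, t \in `[a, b] -> f t = Num.min (f t) (g t)).
  by apply: filterS fg => t fg tab; rewrite min_l// fg.
rewrite (Rintegral_ae_eq _ bmin fE); last by case: bf.
apply: le_Rintegral => //; last by move=> t _; rewrite ge_min lexx orbT.
- apply: bounded_measurable_integrable; split => //.
  case: bf bg => [_ [M fM]] [_ [N gN]]; exists (M + N) => t tab.
  have [M0 N0] : 0 <= M /\ 0 <= N by split; [exact: le_trans (fM t tab)|exact:
    le_trans (gN t tab)].
  by rewrite /Num.min; case: ifP => _; [rewrite (le_trans (fM t tab))//
    lerDl|rewrite (le_trans (gN t tab))// lerDr].
- exact: bounded_measurable_integrable.
Qed.

Lemma bounded_Rintegral_le a b f (M : R) : a <= b ->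
  measurable_fun (`[a, b] : set (lebT R)) (f : lebT R -> R) ->
  (forall t, t \in `[a, b] -> `|f t| <= M) ->
  `|\int[leb R]_(t in `[a, b]) f t| <= M * (b - a).
Proof.
move=> ab mf fM; have bf : bounded_measurable a b f by split => //; exists M.
apply: (le_trans (le_normr_Rintegral _ (bounded_measurable_integrable bf))) => //.
have -> : M * (b - a) = \int[leb R]_(t in `[a, b]) M.
  rewrite Rintegral_cst//; congr (_ * _).
  exact: (esym (congr1 fine (leb_itvcc ab))).
apply: le_Rintegral => //.
- by apply: bounded_measurable_integrable; exact: bounded_measurable_norm.
- by apply: bounded_measurable_integrable; exact: bounded_measurable_cst.
Qed.

Lemma bounded_Rintegral_cvg a b (f_ : nat -> R -> R) f (M : R) :
  (forall k, measurable_fun (`[a, b] : set (lebT R)) (f_ k : lebT R -> R)) ->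
  (forall k, \forall t \ae leb R, t \in `[a, b] -> `|f_ k t| <= M) ->
  measurable_fun (`[a, b] : set (lebT R)) (f : lebT R -> R) ->
  (\forall t \ae leb R, t \in `[a, b] -> f_ k t @[k --> \oo] --> f t) ->
  (\int[leb R]_(t in `[a, b]) f_ k t)%R @[k --> \oo] -->
  \int[leb R]_(t in `[a, b]) f t.
Proof.
move=> mf_ fM mf ff.
have [|||//|||] := @dominated_convergence _ _ _ (leb R) (`[a, b]%classic) _
  (fun k => EFin \o f_ k) (EFin \o f) (EFin \o cst M).
- exact: measurable_lebT_itv.
- by move=> k; exact/measurable_EFinP.
- exact/measurable_EFinP.
- by apply: filterS ff => t ff tab; apply: cvg_EFin; [exact: nearW|exact: ff].
- by apply: bounded_measurable_integrable; exact: bounded_measurable_cst.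
- have : \forall t \ae leb R, forall k, t \in `[a, b] -> `|f_ k t| <= M.
    exact: ae_foralln.
  by apply: filterS => t tM k tab; rewrite /= lee_fin; exact: tM.
- move=> intf _ fcvg.
  apply: fine_cvg; rewrite fineK//.
  apply: integrable_fin_num => //.
Qed.

End bounded_measurable.
#[local] Hint Resolve measurable_lebT_itv : core.

(** * Lipschitz and absolutely continuous functions *)

Section lipschitz_derivative.
Context {R : realType}.
Implicit Types (a b s t L T : R) (F f h : R -> R).

(** The projection onto [[0, T]]. Trajectories are constrained only there; composed with it they
    become Lipschitz on the whole line. *)
Definition clamp T t : R := Num.max 0 (Num.min t T).

Lemma clamp_itv T t : 0 <= T -> clamp T t \in `[0, T].
Proof.
by move=> T0; rewrite in_itv/= /clamp le_max lexx/= ge_max T0 ge_min lexx orbT.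
Qed.

Lemma clampE T t : t \in `[0, T] -> clamp T t = t.
Proof. by rewrite in_itv/= => /andP[t0 tT]; rewrite /clamp min_l// max_r. Qed.

Lemma clamp_le T s t : s <= t -> clamp T s <= clamp T t.
Proof.
move=> st; rewrite /clamp; case: (leP s T) => ?; case: (leP t T) => ?;
  case: (leP 0 s) => ?; case: (leP 0 t) => ?; case: (leP 0 T) => ?; lra.
Qed.

Lemma clamp_dist T s t : `|clamp T s - clamp T t| <= `|s - t|.
Proof.
wlog st : s t / s <= t.
  move=> H; have [|/ltW] := leP s t; first exact: H.
  by rewrite distrC (distrC s); exact: H.
have := clamp_le T st => cst; rewrite !ler0_norm ?subr_le0//; move: cst.
rewrite /clamp; case: (leP s T) => ?; case: (leP t T) => ?;
  case: (leP 0 s) => ?; case: (leP 0 t) => ?; case: (leP 0 T) => ?; lra.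
Qed.

Definition lipschitz L F : Prop := forall s t, `|F s - F t| <= L * `|s - t|.

Lemma lipschitz_ge0 L F : lipschitz L F -> 0 <= L.
Proof. by move=> /(_ 0 1); rewrite sub0r normrN1 mulr1; exact: le_trans. Qed.

Lemma lipschitz_continuous L F : lipschitz L F -> continuous F.
Proof.
move=> lF t; have L0 := lipschitz_ge0 lF.
apply/(@cvgrPdist_lt _ R^o) => e e0; near=> s.
apply: (le_lt_trans (lF t s)).
have : `|t - s| < e / (L + 1).
  near: s; apply: cvgr_dist_lt; first exact: cvg_id.
  by rewrite divr_gt0// ltr_wpDl.
rewrite ltr_pdivlMr ?ltr_wpDl// => /(le_lt_trans _); apply.
by rewrite mulrC ler_wpM2l// lerDl.
Unshelve. all: by end_near. Qed.

Lemma lipschitz_is_derive_le L F t (l : R) : lipschitz L F ->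
  is_derive t 1 F l -> `|l| <= L.
Proof.
move=> lF [dF <-]; rewrite leNgt; apply/negP => Ll.
have : h^-1 *: (F (h *: (1 : R) + t) - F t) @[h --> 0^'] --> 'D_1 F t by [].
move=> /(@cvgrPdist_lt _ R^o)/(_ (`|'D_1 F t| - L)).
rewrite subr_gt0 => /(_ Ll) dl.
have [s [s0 ds]] : exists s : R, s != 0 /\
    `|'D_1 F t - s^-1 *: (F (s *: (1 : R) + t) - F t)| < `|'D_1 F t| - L.
  near (0 : R)^' => s; exists s; split; last by near: s.
  by near: s; exact: nbhs_dnbhs_neq.
have {}ds : L < `|s^-1 *: (F (s *: (1 : R) + t) - F t)|.
  have := lerB_dist ('D_1 F t) (s^-1 *: (F (s *: (1 : R) + t) - F t)); lra.
move: ds; rewrite normrM normfV ltNge => /negP; apply.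
rewrite ler_pdivrMl ?normr_gt0// mulrC; apply: (le_trans (lF _ _)).
by rewrite /= addrK /GRing.scale/= mulr1.
Unshelve. all: by end_near. Qed.

Lemma is_derive_quotient_right F t (l : R) : is_derive t (1 : R) F l ->
  m.+1%:R * (F (t + m.+1%:R^-1) - F t) @[m --> \oo] --> l.
Proof.
move=> [dF <-].
have : s^-1 *: (F (s *: (1 : R) + t) - F t) @[s --> 0^'] --> 'D_1 F t by [].
move=> /cvgr_dnbhsP/(_ (fun m => m.+1%:R^-1)) H.
apply: cvg_trans (H _); last by split=> [m|]; [|exact: cvg_harmonic].
apply: near_eq_cvg; apply: nearW => m /=.
by rewrite /GRing.scale/= mulr1 invrK (addrC _ t).
Qed.

Lemma is_derive_quotient_left F t (l : R) : is_derive t (1 : R) F l ->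
  m.+1%:R * (F t - F (t - m.+1%:R^-1)) @[m --> \oo] --> l.
Proof.
move=> [dF <-].
have : s^-1 *: (F (s *: (1 : R) + t) - F t) @[s --> 0^'] --> 'D_1 F t by [].
move=> /cvgr_dnbhsP/(_ (fun m => - m.+1%:R^-1)) H.
apply: cvg_trans (H _); last first.
  split=> [m|]; first by rewrite oppr_eq0.
  by rewrite -[X in _ --> X]oppr0; apply: cvgN; exact: cvg_harmonic.
apply: near_eq_cvg; apply: nearW => m /=.
by rewrite /GRing.scale/= mulr1 invrN invrK (addrC _ t) mulNr -mulrN opprB.
Qed.

Lemma is_derive_le0 F t b (l : R) : t < b -> is_derive t (1 : R) F l ->
  (forall s, t <= s -> s <= b -> F s <= F t) -> l <= 0.
Proof.
move=> tb /is_derive_quotient_right dF Fle.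
have bt : 0 < b - t by rewrite subr_gt0.
apply: (cvgr_to_le dF); near=> m.
rewrite pmulr_rle0// subr_le0; apply: Fle; first by rewrite lerDl invr_ge0.
rewrite -lerBrDl ltW//; near: m.
exact: (near_infty_natSinv_lt (PosNum bt)).
Unshelve. all: by end_near. Qed.

Lemma is_derive_max F T t (l : R) : t \in `]0, T[ -> is_derive t (1 : R) F l ->
  (forall s, s \in `[0, T] -> F s <= F t) -> l = 0.
Proof.
rewrite in_itv/= => /andP[t0 tT] dF Fle; apply/eqP; rewrite eq_le.
apply/andP; split.
  apply: (is_derive_le0 tT dF) => s ts sT; apply: Fle.
  by rewrite in_itv/= sT (le_trans (ltW t0)).
apply: (cvgr_to_ge (is_derive_quotient_left dF)); near=> m.
rewrite pmulr_rge0// subr_ge0; apply: Fle; rewrite in_itv/=; apply/andP; split.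
  rewrite subr_ge0 ltW//; near: m; exact: (near_infty_natSinv_lt (PosNum t0)).
by rewrite (le_trans _ (ltW tT))// gerBl invr_ge0.
Unshelve. all: by end_near. Qed.

(** A cover of the null set by half-open intervals of small total length also has small total
    Stieltjes length, each term growing at most by the factor [L]. The denominator [L + 1] allows
    for [L = 0]. *)
Lemma stieltjes_null L (f : cumulative R R) (A : set R) : 0 <= L ->
  (forall a b, a <= b -> f b - f a <= L * (b - a)) ->
  @lebesgue_measure R A = 0%E -> lebesgue_stieltjes_measure f A = 0%E.
Proof.
move=> L0 fL A0; apply/eqP; rewrite eq_le outer_measure_ge0 andbT.
apply/lee_addgt0Pr => e e0; rewrite add0e.
have [_ [B [mB AB] <-]] : exists2 x, [set (\sum_(0 <= k <oo) @wlength R idfun (B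
  k))%E | B in
     @measurable_cover _ (ocitv_type R) A] x & (x < (e / (L + 1))%:E)%E.
  apply: ereal_inf_lt; rewrite [X in (X < _)%E](_ : _ = @lebesgue_measure R A)//.
  by rewrite A0 lte_fin divr_gt0// ltr_wpDl.
move=> Be.
have wle (X : set R) : ocitv X -> (wlength f X <= L%:E * @wlength R idfun X)%E.
  move=> /ocitvP[->|[[a b] /= ab ->]]; first by rewrite !wlength0 mule0.
  by rewrite !wlength_itv_bnd ?(ltW ab)// -EFinM lee_fin fL// ltW.
apply: (@le_trans _ _ (\sum_(0 <= k <oo) wlength f (B k))%E).
  by apply: ereal_inf_lbound; exists B.
apply: (@le_trans _ _ (\sum_(0 <= k <oo) L%:E * @wlength R idfun (B k))%E).
  apply: lee_nneseries => [k _ _|k _]; first exact: wlength_ge0.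
  by apply: wle; exact: mB.
rewrite nneseriesZl//.
apply: (@le_trans _ _ (L%:E * (e / (L + 1))%:E)%E).
  by rewrite lee_wpmul2l ?lee_fin// ltW.
rewrite -EFinM lee_fin mulrCA ger_pMr// ler_pdivrMr ?ltr_wpDl// mul1r.
by rewrite lerDl.
Qed.

Lemma integral_is_derive (q : R -> R) :
  (@lebesgue_measure R).-integrable setT (EFin \o q) ->
  \forall t \ae @lebesgue_measure R, (0 : R) < t ->
    is_derive t (1 : R) (fun y => \int[@lebesgue_measure R]_(x in `[0, y]) q x)
      (q t).
Proof.
move=> iq; have /FTC1 : forall y, (@lebesgue_measure R).-integrable
    [set` Interval (BLeft (0 : R)) (BRight y)] (EFin \o q).
  by move=> y; apply: integrableS iq => //; exact: measurable_itv.
move=> /(_ (open_integrable_locally openT iq)).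
apply: filterS; first exact: (ae_filter_ringOfSetsType (@lebesgue_measure R)).
move=> t H t0; have [|dq qE] := H; first by rewrite lte_fin.
by split; [exact: dq|rewrite -derive1E].
Qed.

Lemma leb_ae_neq a : \forall t \ae leb R, t != a.
Proof.
exists [set a]; split => //=.
- by apply: borel_lebT; exact: measurable_set1.
- exact: (lebesgue_measure_set1 a).
- by move=> t /= /negP; rewrite negbK => /eqP.
Qed.

(** A two-sided derivative is determined by the values on [[0, T]] at interior times only; the
    endpoints form a null set. *)
Lemma leb_ae_itvcc T (P : R -> Prop) :
  (\forall t \ae leb R, t \in `](0 : R), T[ -> P t) ->
  \forall t \ae leb R, t \in `[(0 : R), T] -> P t.
Proof.
move=> H; have := leb_ae_neq 0; have := leb_ae_neq T; move: H.
apply: filterS3 => t + tT t0; rewrite !in_itv/= => H /andP[t0' tT'].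
by apply: H; rewrite !lt_neqAle eq_sym t0 t0' tT tT'.
Qed.

(* Radon-Nikodym for the Stieltjes measure of the nondecreasing function
   L t + F t, which is dominated by 2 L times the Lebesgue measure. *)
Lemma lipschitz_derivative T L F : 0 < T -> lipschitz L F ->
  exists h : R -> R, [/\ measurable_fun setT h, forall t, `|h t| <= L,
    \forall t \ae leb R, t \in `[(0 : R), T] -> is_derive t (1 : R) F (h t)
    & forall a b, 0 <= a -> a <= b -> b <= T ->
        \int[leb R]_(t in `[a, b]) h t = F b - F a].
Proof.
move=> T0 lF; have L0 := lipschitz_ge0 lF.
(* Adding [L t] makes [F] nondecreasing, and clamping makes the result constant on either side of
   [[0, T]]. *)
pose Fc t := L * clamp T t + F (clamp T t).
have ndF : nondecreasing Fc.
  move=> s t st; rewrite /Fc -subr_ge0.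
  have := lF (clamp T s) (clamp T t); have := clamp_le T st.
  have := ler_norm (F (clamp T s) - F (clamp T t)).
  move=> H1 cst; rewrite (ler0_norm (_ : clamp T s - clamp T t <= 0)) ?subr_le0//.
  move: H1; lra.
have lFc : lipschitz (L + L) Fc.
  move=> s t; rewrite /Fc [X in `|X|](_ : _ = L * (clamp T s - clamp T t) +
    (F (clamp T s) - F (clamp T t))); last by ring.
  rewrite mulrDl; apply: (le_trans (ler_normD _ _)); apply: lerD.
    by rewrite normrM (ger0_norm L0) ler_wpM2l// clamp_dist.
  by apply: (le_trans (lF _ _)); rewrite ler_wpM2l// clamp_dist.
have rcF : right_continuous Fc.
  by apply: right_continuousW; exact: lipschitz_continuous lFc.
pose G : cumulative R R := HB.pack Fc (isCumulative.Build R _ R Fc ndF rcF).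
have mD : measurable (`]0, T] : set (measurableTypeR R)) by exact: measurable_itv.
have GD a b : a <= b ->
    lebesgue_stieltjes_measure G `]a, b]%classic = (Fc b - Fc a)%:E.
  move=> ab.
  rewrite -(wlength_itv_bnd Fc false false ab).
  exact: (@measurable_mu_extE _ _ _ (wlength G) _ (is_ocitv a b)).
have foo : (lebesgue_stieltjes_measure G `]0%R, T]%classic < +oo)%E.
  by rewrite GD ?ltW// ltry.
(* Restricted to []0, T]] the Stieltjes measure is finite, as the Radon-Nikodym theorem requires. *)
pose nu := mfrestr mD foo.
have numu : nu `<< @lebesgue_measure R.
  apply/null_content_dominatesP => A mA A0; rewrite /nu /mfrestr /mrestr.
  apply: (@stieltjes_null (L + L)) => //.
  - by rewrite addr_ge0.
  - move=> a b ab; have := lFc b a; rewrite (ger0_norm (_ : 0 <= b - a))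
    ?subr_ge0//.
    by apply: le_trans; exact: ler_norm.
  - apply: (@subset_measure0 _ _ _ (@lebesgue_measure R) _ A) => //.
    exact: measurableI.
have [h0 [h00 h0f ih0 nuE]] := radon_nikodym_sigma_finite numu.
pose h1 t := fine (h0 t).
have h0E : EFin \o h1 = h0 by apply/funext => t /=; rewrite fineK.
have ih1 : (@lebesgue_measure R).-integrable setT (EFin \o h1) by rewrite h0E.
have mh1 : measurable_fun [set: R] h1.
  by case/integrableP : ih1 => /measurable_EFinP.
have FcE t : t \in `[0, T] -> Fc t = L * t + F t by move=> tT; rewrite /Fc clampE.
have inth1 a b : 0 <= a -> a <= b -> b <= T ->
    \int[@lebesgue_measure R]_(t in `[a, b]) h1 t = F b - F a + L * (b - a).
  move=> a0 ab bT; rewrite -Rintegral_itv_obnd_cbnd; last first.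
    by apply: integrableS ih1 => //; exact: measurable_itv.
  rewrite /Rintegral (_ : (fun x => (h1 x)%:E) = h0)//.
  have : lebesgue_stieltjes_measure G (`]a, b]%classic `&` `]0, T]%classic) =
      (\int[@lebesgue_measure R]_(x in `]a, b]) h0 x)%E.
    exact: (nuE _ (measurable_itv `]a, b])).
  rewrite (_ : `]a, b]%classic `&` `]0, T]%classic = `]a, b]%classic); last first.
    apply/seteqP; split => t /=; first by move=> [].
    rewrite !in_itv/= => /andP[ta tb]; split; first by rewrite ta tb.
    by rewrite (le_lt_trans a0)//= (le_trans tb).
  rewrite GD// => <-.
  rewrite /= !FcE; first by ring.
    by rewrite in_itv/= a0 (le_trans ab).
  by rewrite in_itv/= bT (le_trans a0).
have dF : \forall t \ae leb R, t \in `[(0 : R), T] ->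
  is_derive t (1 : R) F (h1 t - L).
  apply: leb_ae_itvcc; have := ae_lebesgue_leb (integral_is_derive ih1).
  apply: filterS => t H /[!in_itv]/= /andP[t0 tT].
  pose J y := \int[@lebesgue_measure R]_(x in `[0, y]) h1 x.
  have JF : {near t, (fun y => J y - (L * y - F 0)) =1 F}.
    near=> y; rewrite /J /= inth1 ?subr0//; first by ring.
    - by near: y; exact: lt_le_nbhsr.
    - by near: y; exact: lt_le_nbhsl.
  apply: (near_eq_is_derive JF).
  have dl : is_derive t (1 : R) (fun y => L * y - F 0) (L *: 1 - 0).
    exact: (is_deriveB (is_deriveZ L (is_derive_id t 1)) (is_derive_cst (F 0) t 1)).
  rewrite subr0 /GRing.scale/= mulr1 in dl.
  exact: (is_deriveB (H t0) dl).
(* The density [h1 - L] is known to be bounded by [L] only where it is the derivative of [F].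
   Clipping enforces the bound everywhere and alters the density on a null part of [[0, T]] only. *)
pose h t := Num.max (- L) (Num.min L (h1 t - L)).
have hL t : `|h t| <= L.
  rewrite ler_norml /h le_max lexx/= ge_max ge_min lexx/= andbT; lra.
have hE : \forall t \ae leb R, t \in `[(0 : R), T] -> h t = h1 t - L.
  apply: filterS dF => t H tT; rewrite /h.
  have := lipschitz_is_derive_le lF (H tT); rewrite ler_norml => /andP[? ?].
  by rewrite min_r// max_r.
have mh : measurable_fun [set: R] h.
  apply: measurable_maxr => //; apply: measurable_minr => //.
  exact: measurable_funB.
exists h; split => //.
  by have := hE; move: dF; apply: filterS2 => t dFt hEt tT; rewrite hEt//;
    exact: dFt.
move=> a b a0 ab bT; apply: (@addIr _ (L * (b - a))); rewrite -inth1//.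
have bmh : bounded_measurable a b h.
  by split; [apply: borel_lebT_fun => //; exact: measurable_funTS|exists L].
rewrite Rintegral_lebesgue_leb//; last exact: measurable_funTS.
transitivity (\int[leb R]_(t in `[a, b]) (h t + L)).
  rewrite RintegralD//; first last.
  - exact: (bounded_measurable_integrable (bounded_measurable_cst a b L)).
  - exact: bounded_measurable_integrable.
  rewrite Rintegral_cst//; congr (_ + _ * _).
  exact: (esym (congr1 fine (leb_itvcc ab))).
apply: Rintegral_ae_eq.
- by case: (bounded_measurableD bmh (bounded_measurable_cst a b L)).
- by apply: borel_lebT_fun => //; exact: measurable_funTS.
apply: filterS hE => t hEt tab; rewrite hEt ?subrK//.
by move: tab; rewrite !in_itv/= => /andP[ta tb];
  rewrite (le_trans a0)//= (le_trans tb).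
Unshelve. all: by end_near. Qed.

End lipschitz_derivative.

(** * Primitives, integration by parts, weak convergence of derivatives *)

Section primitives.
Context {R : realType}.
Implicit Types (a b c s t L M T : R) (F f h p q : R -> R).

Lemma bounded_measurable_patch a b c d p : a <= c -> d <= b ->
  bounded_measurable a b p -> bounded_measurable a b (p \_ `[c, d]).
Proof.
move=> ac db bp; have [mp [M pM]] := bp.
split; last first.
  exists M => t tab; rewrite patchE; case: ifP => _; first exact: pM.
  by rewrite normr0; apply: le_trans (pM t tab).
apply/(@measurable_restrict _ _ (lebT R)) => //.
by apply: measurable_funS mp => // t [].
Qed.

Lemma Rintegral_itv_split a b c p : a <= b -> b <= c ->
  bounded_measurable a c p ->
  \int[leb R]_(t in `[a, c]) p t =
  \int[leb R]_(t in `[a, b]) p t + \int[leb R]_(t in `[b, c]) p t.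
Proof.
move=> ab bc bp.
have sub d e : a <= d -> e <= c -> (`[a, c] `&` `[d, e] = `[d, e])%classic.
  move=> ad ec; apply/seteqP; split => t /=; first by move=> [].
  rewrite !in_itv/= => /andP[dt te]; split; last by rewrite dt te.
  by rewrite (le_trans ad)// (le_trans te).
have bpl := bounded_measurable_patch (lexx a) bc bp.
have bpr := bounded_measurable_patch ab (lexx c) bp.
rewrite -(sub a b)// Rintegral_mkcondr -(sub b c)// Rintegral_mkcondr.
rewrite -RintegralD//; [|exact: bounded_measurable_integrable..].
apply: Rintegral_ae_eq; [by case: bp|by case: (bounded_measurableD bpl bpr)|].
apply: filterS (leb_ae_neq b) => t tb; rewrite in_itv/= => /andP[at_ tc].
rewrite !patchE !mem_setE !in_itv/= at_ tc/=.
have [tb'|bt] := leP t b; last by rewrite ltW// add0r.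
by rewrite leNgt lt_neqAle tb tb'/= addr0.
Qed.

(** Extended by 0 and replaced by a Borel function equal to it almost everywhere, [p] falls under
    the Lebesgue differentiation theorem; the two primitives agree near every interior time. *)
Lemma primitive_is_derive T p : bounded_measurable 0 T p ->
  \forall t \ae leb R, t \in `[(0 : R), T] ->
    is_derive t (1 : R) (fun y => \int[leb R]_(x in `[0, y]) p x) (p t).
Proof.
move=> bp; have [mp [M pM]] := bp.
pose p0 : R -> R := p \_ `[0, T].
have mp0 : measurable_fun [set: lebT R] (p0 : lebT R -> R).
  exact: (iffLR (measurable_restrictT _ (measurable_lebT_itv `[0, T])) mp).
have [q mq [p0q qE]] := lebT_borel_ae mp0.
have qM t : `|q t| <= `|M|.
  have p0M : `|p0 t| <= `|M|.
    rewrite /p0 patchE; case: ifP => [/set_mem tT|_]; last by rewrite normr0.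
    by apply: (le_trans (pM t tT)); exact: ler_norm.
  by case: (qE t) => ->//; rewrite normr0.
have iq : (@lebesgue_measure R).-integrable setT (EFin \o q).
  have -> : EFin \o q = (EFin \o q) \_ `[0, T].
    apply/funext => t; rewrite patchE; case: ifPn => // tT /=.
    by case: (qE t) => -> //; rewrite /p0 patchE (negbTE tT).
  rewrite -integrable_mkcond; last exact: measurable_itv.
  apply: measurable_bounded_integrable.
  - exact: measurable_itv.
  - exact: (leb_itvcc_fin 0 T).
  - exact: measurable_funTS.
  - by exists `|M|; split; [exact: num_real|move=> x Mx t _ /=;
    apply: (le_trans (qM t)); exact: ltW].
apply: leb_ae_itvcc.
move: (p0q) (ae_lebesgue_leb (integral_is_derive iq)).
apply: filterS2 => t p0qt dq; rewrite in_itv/= => /andP[t0 tT].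
have pqt : p t = q t.
  by rewrite -p0qt /p0 patchE mem_set//= in_itv/= !ltW.
rewrite pqt; apply: (near_eq_is_derive _ (dq t0)).
near=> y; have yT : y <= T by near: y; exact: lt_le_nbhsl.
rewrite Rintegral_lebesgue_leb//; [|exact: measurable_funTS].
have bp' := bounded_measurableS (lexx 0) yT bp.
apply: Rintegral_ae_eq; [|by case: bp'|].
  by apply: borel_lebT_fun => //; exact: measurable_funTS.
apply: filterS p0q => x <-; rewrite in_itv/= => /andP[x0 xy].
by rewrite /p0 patchE mem_set//= in_itv/= x0 (le_trans xy).
Unshelve. all: by end_near. Qed.

Lemma primitive_lipschitz T p M : 0 <= T ->
  measurable_fun (`[(0 : R), T] : set (lebT R)) (p : lebT R -> R) ->
  (forall t, t \in `[0, T] -> `|p t| <= M) ->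
  lipschitz M (fun y => \int[leb R]_(x in `[0, clamp T y]) p x).
Proof.
move=> T0 mp pM.
have M0 : 0 <= M.
  by apply: (le_trans (normr_ge0 (p 0)) (pM 0 _)); rewrite in_itv/= lexx T0.
have bp : bounded_measurable 0 T p by split => //; exists M.
move=> s t; wlog st : s t / t <= s.
  move=> H; have [|/ltW] := leP t s; first exact: H.
  by rewrite distrC (distrC s); exact: H.
have := clamp_itv t T0; have := clamp_itv s T0; rewrite !in_itv/=.
move=> /andP[s0 sT] /andP[t0 tT]; have cts := clamp_le T st.
rewrite (Rintegral_itv_split t0 cts); last exact: bounded_measurableS bp.
rewrite [X in `|X|](_ : _ = \int[leb R]_(x in `[clamp T t, clamp T s]) p x);
  last by ring.
have [mp' _] := bounded_measurableS t0 sT bp.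
apply: (le_trans (@bounded_Rintegral_le _ _ _ _ M cts mp' _)).
  by move=> x; rewrite in_itv/= => /andP[tx xs]; apply: pM;
    rewrite in_itv/= (le_trans t0)//= (le_trans xs).
by rewrite ler_wpM2l//; have := clamp_dist T s t; apply: le_trans; exact: ler_norm.
Qed.

Lemma is_derive_unique F t (l l' : R) : is_derive t (1 : R) F l ->
  is_derive t (1 : R) F l' -> l = l'.
Proof. by move=> [_ <-] [_ <-]. Qed.

Lemma is_derive_clamp T F t (l : R) : t \in `]0, T[ ->
  is_derive t (1 : R) (F \o clamp T) l <-> is_derive t (1 : R) F l.
Proof.
rewrite in_itv/= => /andP[t0 tT].
have E : {near t, (F \o clamp T) =1 F}.
  near=> s; rewrite /= clampE// in_itv/=; apply/andP; split.
    by near: s; exact: lt_le_nbhsr.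
  by near: s; exact: lt_le_nbhsl.
split; apply: near_eq_is_derive => //.
by apply: filterS E => s ->.
Unshelve. all: by end_near. Qed.

Lemma lipschitz_clamp T L F : lipschitz L F -> lipschitz L (F \o clamp T).
Proof.
move=> lF s t; apply: (le_trans (lF _ _)).
by rewrite ler_wpM2l ?clamp_dist//; exact: lipschitz_ge0 lF.
Qed.

(** Derivatives are unique, so [f] agrees almost everywhere with the density given by
    [lipschitz_derivative], whose integrals are the increments of [F]. *)
Lemma lipschitz_FTC T L F f a b : lipschitz L F ->
  measurable_fun (`[0, T] : set (lebT R)) (f : lebT R -> R) ->
  (\forall t \ae leb R, t \in `[(0 : R), T] -> is_derive t (1 : R) F (f t)) ->
  0 < T -> 0 <= a -> a <= b -> b <= T ->
  \int[leb R]_(t in `[a, b]) f t = F b - F a.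
Proof.
move=> lF mf dF T0 a0 ab bT.
have [h [mh _ dh hE]] := lipschitz_derivative T0 lF.
have sub t : t \in `[a, b] -> t \in `[0, T].
  by rewrite !in_itv/= => /andP[at_ tb]; rewrite (le_trans a0)//= (le_trans tb).
rewrite -hE//; apply: Rintegral_ae_eq.
- by apply: measurable_funS mf => //; exact: sub.
- by apply: borel_lebT_fun => //; exact: measurable_funTS.
- move: dF dh; apply: filterS2 => t dF dh /sub tT.
  exact: is_derive_unique (dF tT) (dh tT).
Qed.

(** A product of Lipschitz functions is Lipschitz where both factors are bounded; on [[0, T]] each
    is bounded by the modulus of its value at 0 plus its constant times [T]. *)
Lemma lipschitzM_clamp T L M F G : 0 <= T -> lipschitz L F -> lipschitz M G ->
  exists N, lipschitz N ((fun t => F t * G t) \o clamp T).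
Proof.
move=> T0 lF lG.
have L0 := lipschitz_ge0 lF; have M0 := lipschitz_ge0 lG.
have bnd K H : lipschitz K H -> forall t, `|H (clamp T t)| <= `|H 0| + K * T.
  move=> lH t; rewrite -[H (clamp T t)](subrKC (H 0)).
  apply: (le_trans (ler_normD _ _)); apply: lerD => //.
  apply: (le_trans (lH _ _)); rewrite ler_wpM2l ?(lipschitz_ge0 lH)// subr0.
  by have := clamp_itv t T0; rewrite in_itv/= => /andP[c0 cT]; rewrite ger0_norm.
exists ((`|F 0| + L * T) * M + L * (`|G 0| + M * T)) => s t /=.
rewrite [X in `|X|](_ : _ = F (clamp T s) * (G (clamp T s) - G (clamp T t)) +
  (F (clamp T s) - F (clamp T t)) * G (clamp T t)); last by ring.
rewrite [leRHS]mulrDl.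
apply: (le_trans (ler_normD _ _)); apply: lerD; rewrite normrM.
- rewrite -mulrA; apply: ler_pM => //; first exact: bnd.
  exact: (@lipschitz_clamp T _ _ lG s t).
- rewrite mulrAC; apply: ler_pM => //; last exact: bnd.
  exact: (@lipschitz_clamp T _ _ lF s t).
Qed.

Lemma lipschitz_by_parts T L M F G f g a b : lipschitz L F -> lipschitz M G ->
  bounded_measurable 0 T f -> bounded_measurable 0 T g ->
  (\forall t \ae leb R, t \in `[(0 : R), T] -> is_derive t (1 : R) F (f t)) ->
  (\forall t \ae leb R, t \in `[(0 : R), T] -> is_derive t (1 : R) G (g t)) ->
  0 < T -> 0 <= a -> a <= b -> b <= T ->
  \int[leb R]_(t in `[a, b]) (F t * g t + G t * f t) = F b * G b - F a * G a.
Proof.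
move=> lF lG [mf _] [mg _] dF dG T0 a0 ab bT.
have [N lFG] := lipschitzM_clamp (ltW T0) lF lG.
rewrite (lipschitz_FTC lFG _ _ T0 a0 ab bT).
- by rewrite /= !clampE// in_itv/= ?a0 ?bT ?(le_trans ab)// (le_trans a0).
- apply: measurable_funD; apply: measurable_funM => //;
    apply: lebT_continuous_measurable.
    exact: lipschitz_continuous lF.
  exact: lipschitz_continuous lG.
apply: leb_ae_itvcc; move: dF dG; apply: filterS2 => t dF dG tT.
apply/(is_derive_clamp _ _ tT).
have tT' : t \in `[0, T] by move: tT; rewrite !in_itv/= => /andP[? ?]; rewrite !ltW.
exact: (is_deriveM (dF tT') (dG tT')).
Qed.

(* Approximate p by the difference quotients of its primitive, which are
   Lipschitz, and integrate by parts against q_k - q. *)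
Lemma Rintegral_derivative_cvg T L p (q_ : nat -> R -> R) (q : R -> R)
    (h_ : nat -> R -> R) (h : R -> R) : 0 < T ->
  bounded_measurable 0 T p ->
  (forall k, lipschitz L (q_ k)) -> lipschitz L q ->
  (forall t, t \in `[0, T] -> q_ k t @[k --> \oo] --> q t) ->
  (forall k, bounded_measurable 0 T (h_ k)) -> bounded_measurable 0 T h ->
  (forall k, \forall t \ae leb R, t \in `[(0 : R), T] ->
    is_derive t (1 : R) (q_ k) (h_ k t)) ->
  (\forall t \ae leb R, t \in `[(0 : R), T] -> is_derive t (1 : R) q (h t)) ->
  (\int[leb R]_(t in `[0, T]) (p t * h_ k t))%R @[k --> \oo] -->
  \int[leb R]_(t in `[0, T]) (p t * h t).
Proof.
move=> T0 bp lq_ lq q_q bh_ bh dq_ dq.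
have L0 := lipschitz_ge0 lq.
have [mp [M pM]] := bp.
pose P y := \int[leb R]_(x in `[0, clamp T y]) p x.
have lP : lipschitz M P by apply: primitive_lipschitz => //; exact: ltW.
have dP : \forall t \ae leb R, t \in `[(0 : R), T] -> is_derive t (1 : R) P (p t).
  apply: leb_ae_itvcc; apply: filterS (primitive_is_derive bp) => t dp tT.
  apply: (iffRL (@is_derive_clamp T (fun y => \int[leb R]_(x in `[0,
    y]) p x) _ _ tT)).
  by apply: dp; move: tT; rewrite !in_itv/= => /andP[? ?]; rewrite !ltW.
(* These quotients are bounded by [M] uniformly in [m] and Lipschitz for each fixed [m]: the former
   gives dominated convergence to [p], the latter allows integration by parts. *)
pose D m t := m.+1%:R * (P (t + m.+1%:R^-1) - P t).
have lD m : lipschitz (m.+1%:R * (M + M)) (D m).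
  move=> s t; rewrite /D -mulrBr normrM ger0_norm// -mulrA ler_wpM2l//.
  have E (p1 p2 p3 p4 : R) : p1 - p2 - (p3 - p4) = p1 - p3 - (p2 - p4) by ring.
  rewrite E.
  apply: (le_trans (ler_normB _ _)); rewrite mulrDl; apply: lerD => //.
  by apply: (le_trans (lP _ _)); rewrite [X in `|X|](_ : _ = s - t)//; ring.
have DM m t : `|D m t| <= M.
  rewrite /D normrM ger0_norm// -ler_pdivlMl//; apply: (le_trans (lP _ _)).
  by rewrite addrAC subrr add0r ger0_norm// mulrC.
have mD m : measurable_fun (`[0, T] : set (lebT R)) (D m : lebT R -> R).
  by apply: lebT_continuous_measurable; exact: lipschitz_continuous (lD m).
have bD m : bounded_measurable 0 T (D m) by split => //; exists M.
have Dp : \forall t \ae leb R, t \in `[(0 : R), T] -> D m t @[m --> \oo] --> p t.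
  by apply: filterS dP => t H tT; exact: is_derive_quotient_right (H tT).
have intDp : (\int[leb R]_(t in `[0, T]) `|p t - D m t|)%R @[m --> \oo] --> (0 : R).
  rewrite [X in _ --> X](_ : _ = \int[leb R]_(t in `[0, T]) 0); last first.
    by rewrite Rintegral_cst// mul0r.
  apply: (@bounded_Rintegral_cvg _ 0 T (fun m t => `|p t - D m t|) (fun=> 0) (M
    + M)).
  - by move=> m; case: (bounded_measurable_norm (bounded_measurableB bp (bD m))).
  - move=> m; apply: nearW => t tT; rewrite normr_id.
    by apply: (le_trans (ler_normB _ _)); apply: lerD => //; exact: pM.
  - exact: measurable_cst.
  - apply: filterS Dp => t Dpt tT; rewrite -(normr0 R) -(subrr (p t)).
    by apply: cvg_norm; apply: cvgB; [exact: cvg_cst|exact: Dpt].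
apply/(@cvgrPdist_lt _ R^o) => e e0.
(* The index [m] is fixed first. Since [h_ k - h] is bounded by [2 L] almost everywhere, this
   controls the replacement of [p] by [D m] uniformly in [k]. *)
have [m Hm] : exists m, 2 * L * \int[leb R]_(t in `[0, T]) `|p t - D m t| < e / 2.
  have L1 : 0 < 2 * L + 1 by rewrite ltr_wpDl// mulr_ge0.
  have : 0 < e / 2 / (2 * L + 1) by rewrite !divr_gt0.
  move: intDp => /(@cvgrPdist_lt _ R^o) /[apply] -[m _ /(_ m (leqnn m))].
  rewrite /= sub0r normrN ltr_pdivlMr// => H.
  exists m; apply: le_lt_trans H; rewrite mulrC; apply: ler_pM => //.
  - by apply: Rintegral_ge0.
  - by rewrite mulr_ge0.
  - exact: ler_norm.
  - by rewrite lerDl.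
have bhh k := bounded_measurableB (bh_ k) bh.
have split k : \int[leb R]_(t in `[0, T]) (p t * h t) - \int[leb R]_(t in `[0,
  T]) (p t * h_ k t) =
  - (\int[leb R]_(t in `[0, T]) ((p t - D m t) * (h_ k t - h t)) +
   \int[leb R]_(t in `[0, T]) (D m t * (h_ k t - h t))).
  have b1 := bounded_measurableM (bounded_measurableB bp (bD m)) (bhh k).
  have b2 := bounded_measurableM (bD m) (bhh k).
  have b3 := bounded_measurableM bp bh; have b4 := bounded_measurableM bp (bh_ k).
  rewrite -RintegralD//; [|exact: bounded_measurable_integrable..].
  rewrite -RintegralB//; [|exact: bounded_measurable_integrable..].
  rewrite -[RHS]mulN1r -RintegralZl//; last first.
    by apply: bounded_measurable_integrable; exact: bounded_measurableD.
  by apply: eq_Rintegral => t _; ring.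
have first k : `|\int[leb R]_(t in `[0, T]) ((p t - D m t) * (h_ k t - h t))| <
  e / 2.
  have b1 := bounded_measurableM (bounded_measurableB bp (bD m)) (bhh k).
  apply: le_lt_trans Hm; apply: (le_trans (le_normr_Rintegral _ _)) => //.
    exact: bounded_measurable_integrable.
  have b2 := bounded_measurable_norm (bounded_measurableB bp (bD m)).
  rewrite -RintegralZl//; last exact: bounded_measurable_integrable.
  apply: Rintegral_ae_le.
  - exact: bounded_measurable_norm.
  - by apply: bounded_measurableM => //; exact: bounded_measurable_cst.
  move: (dq_ k) dq; apply: filterS2 => t dqk dqt tT.
  rewrite normrM mulrC ler_wpM2r// (le_trans (ler_normB _ _))// mulr2n mulrDl
    mul1r lerD//.
    exact: lipschitz_is_derive_le (lq_ k) (dqk tT).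
  exact: lipschitz_is_derive_le lq (dqt tT).
(* With [m] fixed, [D m] has a bounded derivative [w], and integration by parts leaves only values
   of [q_ k - q], which tend to 0 boundedly. *)
have second : (\int[leb R]_(t in `[0, T]) (D m t * (h_ k t - h t)))%R @[k -->
  \oo] --> (0 : R).
  have [w [mw wM dw _]] := lipschitz_derivative T0 (lD m).
  have bw : bounded_measurable 0 T w.
    split; last by exists (m.+1%:R * (M + M)).
    by apply: borel_lebT_fun => //; exact: measurable_funTS.
  have lr k : lipschitz (L + L) (fun t => q_ k t - q t).
    move=> s t; rewrite [X in `|X|](_ : _ = (q_ k s - q_ k t) - (q s - q t));
      last by ring.
    apply: (le_trans (ler_normB _ _)); rewrite mulrDl.
    by apply: lerD; [exact: lq_|exact: lq].
  have dr k : \forall t \ae leb R, t \in `[(0 : R), T] ->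
      is_derive t (1 : R) (fun t => q_ k t - q t) (h_ k t - h t).
    move: (dq_ k) dq; apply: filterS2 => t dqk dqt tT.
    exact: (is_deriveB (dqk tT) (dqt tT)).
  have mr k : measurable_fun (`[0, T] : set (lebT R)) (fun t : lebT R => q_ k t
    - q t).
    by apply: lebT_continuous_measurable; exact: lipschitz_continuous (lr k).
  have r0 t : t \in `[0, T] -> q_ k t - q t @[k --> \oo] --> (0 : R).
    by move=> tT; rewrite -(subrr (q t)); apply: cvgB; [exact: q_q|exact: cvg_cst].
  have in0 : (0 : R) \in `[0, T] by rewrite in_itv/= lexx ltW.
  have inT : T \in `[0, T] by rewrite in_itv/= lexx ltW.
  (* Convergence at 0 bounds [q_ k 0 - q 0], and the Lipschitz constants spread this bound over
     [[0, T]]. *)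
  have [B HB] : exists B, forall k, `|q_ k 0 - q 0| <= B.
    have /cvg_seq_bounded/pinfty_ex_gt0 [B0 _ H] : cvgn (fun k => q_ k 0 - q 0).
      by apply/cvg_ex; exists (0 : R^o); exact: r0.
    by exists B0 => k; exact: H.
  have rB k t : t \in `[0, T] -> `|q_ k t - q t| <= B + (L + L) * T.
    move=> tT; rewrite -[q_ k t - q t](subrKC (q_ k 0 - q 0)).
    apply: (le_trans (ler_normD _ _)); apply: lerD; first exact: HB.
    apply: (le_trans (lr k _ _)); rewrite subr0 ler_wpM2l ?addr_ge0//.
    by move: tT; rewrite in_itv/= => /andP[? ?]; rewrite ger0_norm.
  have br k : bounded_measurable 0 T (fun t => q_ k t - q t).
    by split => //; exists (B + (L + L) * T); exact: rB.
  have E k : \int[leb R]_(t in `[0, T]) (D m t * (h_ k t - h t)) =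
     (D m T * (q_ k T - q T) - D m 0 * (q_ k 0 - q 0)) -
     \int[leb R]_(t in `[0, T]) ((q_ k t - q t) * w t).
    rewrite -(lipschitz_by_parts (lD m) (lr k) bw (bhh k) dw (dr k) T0 (lexx 0)
      (ltW T0) (lexx T)).
    rewrite RintegralD ?addrK//.
      exact: bounded_measurable_integrable (bounded_measurableM (bD m) (bhh k)).
    exact: bounded_measurable_integrable (bounded_measurableM (br k) bw).
  have E0 : (D m T * 0 - D m 0 * 0) - \int[leb R]_(t in `[0, T]) (0 * w t) = 0.
    under eq_Rintegral do rewrite mul0r.
    by rewrite Rintegral_cst// !mul0r !mulr0 !subr0.
  suff : ((D m T * (q_ k T - q T) - D m 0 * (q_ k 0 - q 0)) -
     \int[leb R]_(t in `[0, T]) ((q_ k t - q t) * w t)) @[k --> \oo] -->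
    (D m T * 0 - D m 0 * 0) - \int[leb R]_(t in `[0, T]) (0 * w t).
    by rewrite E0; apply: cvg_trans; apply: near_eq_cvg; apply: nearW => k.
  apply: cvgB.
    by apply: cvgB; apply: cvgM; [exact: cvg_cst|exact: r0|exact: cvg_cst|exact:
      r0].
  apply: (@bounded_Rintegral_cvg _ 0 T (fun k t => (q_ k t - q t) * w t)
    (fun t => 0 * w t) ((B + (L + L) * T) * (m.+1%:R * (M + M)))).
  - by move=> k; case: (bounded_measurableM (br k) bw).
  - move=> k; apply: nearW => t tT; rewrite normrM; apply: ler_pM => //.
    exact: rB.
  - by case: (bounded_measurableM (bounded_measurable_cst 0 T 0) bw).
  - by apply: nearW => t tT; apply: cvgM; [exact: r0|exact: cvg_cst].
move: second => /(@cvgrPdist_lt _ R^o)/(_ (e / 2)) []; first by rewrite divr_gt0.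
move=> N _ HN; exists N => // k /HN; rewrite sub0r normrN => Hk /=.
by rewrite split normrN (le_lt_trans (ler_normD _ _))// (splitr e) ltrD.
Qed.

End primitives.

Section almost_everywhere_subsequence.
Context {R : realType}.

(** Along indices whose integrals are at most 2^-(j+1), the sum of the functions has a finite
    integral, hence is finite almost everywhere, and the terms of a convergent series tend to 0. The
    indices need not increase: [j <= s j] already sends them to infinity. *)
Lemma Rintegral_cvg0_subseq (a b : R) (phi : nat -> R -> R) :
  (forall k, bounded_measurable a b (phi k)) ->
  (forall k t, 0 <= phi k t) ->
  (\int[leb R]_(t in `[a, b]) phi k t)%R @[k --> \oo] --> (0 : R) ->
  exists s : nat -> nat, (forall j, (j <= s j)%N) /\
    \forall t \ae leb R, t \in `[a, b] -> phi (s j) t @[j --> \oo] --> (0 : R).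
Proof.
move=> bphi phi0 cphi.
have step (j : nat) : exists k, (j <= k)%N /\
    \int[leb R]_(t in `[a, b]) phi k t <= 1 / (2 ^ j.+1)%:R.
  have : 0 < 1 / (2 ^ j.+1)%:R :> R.
    by rewrite divr_gt0// ltr0n expn_gt0.
  move: cphi => /(@cvgrPdist_lt _ R^o) /[apply] -[N _ HN].
  exists (maxn N j); split; first exact: leq_maxr.
  by have := HN _ (leq_maxl N j); rewrite /= sub0r normrN => /ltW;
    apply: le_trans; exact: ler_norm.
have [s /all_and2[sj sI]] := choice step; exists s; split => //.
have mE j : measurable_fun (`[a, b] : set (lebT R)) (EFin \o phi (s j)).
  by apply/measurable_EFinP; case: (bphi (s j)).
pose S (t : lebT R) := (\sum_(0 <= j <oo) (phi (s j) t)%:E)%E.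
have iS : (leb R).-integrable (`[a, b] : set (lebT R)) S.
  apply/integrableP; split.
    apply: (@ge0_emeasurable_sum _ (lebT R) R `[a, b]%classic
      (fun j => EFin \o phi (s j)) xpredT) => //.
    by move=> j t _ _; rewrite lee_fin.
  have -> : (\int[leb R]_(t in `[a, b]) `|S t| = \int[leb R]_(t in `[a, b]) S t)%E.
    apply: eq_integral => t _; rewrite gee0_abs//.
    by apply: nneseries_ge0 => j _ _; rewrite lee_fin.
  rewrite integral_nneseries//; last by move=> j t _; rewrite lee_fin.
  apply: (@le_lt_trans _ _ (1%:E)); last exact: ltry.
  apply: le_trans (epsilon_trick0 xpredT (ler01)).
  apply: lee_nneseries => [j _ _|j _]; first by apply: integral_ge0 => t _;
    rewrite lee_fin.
  rewrite -[leLHS]fineK ?lee_fin//; first exact: sI.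
  apply: integrable_fin_num => //; exact: bounded_measurable_integrable.
have := integrable_ae (measurable_lebT_itv `[a, b]) iS.
apply: filterS => t St tab; have {}St := St tab.
have Soo : (\sum_(0 <= j <oo) (phi (s j) t)%:E < +oo)%E by rewrite
  -ge0_fin_numE//; apply: nneseries_ge0 => j _ _; rewrite lee_fin.
have tail := nneseries_tail_cvg Soo (fun j _ => (phi0 (s j) t : (0 <= _%:E)%E)).
have : (phi (s j) t)%:E @[j --> \oo] --> 0%E.
  apply: (squeeze_cvge _ (cvg_cst 0%E) tail); apply: nearW => j.
  rewrite lee_fin phi0/=.
  have := @nneseries_lim_ge R (fun j => (phi (s j) t)%:E) xpredT j j.+1.
  by rewrite big_nat1; apply => i _ _; rewrite lee_fin.
by move/fine_cvg.
Qed.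

End almost_everywhere_subsequence.

(** * Absolutely continuous functions with bounded derivative *)

Section absolutely_continuous_lipschitz.
Context {R : realType}.

Let apart (p q : R * R) : bool := (p.2 <= q.1) || (q.2 <= p.1).

(* A continuous induction along [s, t]: points where F is differentiable with
   |F'| <= M contribute slope M + e, and points of the exceptional null set,
   which is covered by an open set V of small measure, contribute intervals
   contained in V, whose total increment is controlled by absolute continuity. *)
Lemma absolutely_continuous_lipschitz (T M : R) (F : R -> R) : 0 <= M ->
  (forall e : R, 0 < e -> exists2 del : R, 0 < del &
    forall (m : nat) (a b : 'I_m -> R),
      (forall i, [/\ 0 <= a i, a i <= b i & b i <= T]) ->
      (forall i j, i != j -> b i <= a j \/ b j <= a i) ->
      \sum_(i < m) (b i - a i) < del ->
      \sum_(i < m) `|F (b i) - F (a i)| < e) ->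
  (\forall t \ae leb R, t \in `[(0 : R), T] ->
    exists2 l, is_derive t (1 : R) F l & `|l| <= M) ->
  forall s t, 0 <= s -> s <= t -> t <= T -> `|F t - F s| <= M * (t - s).
Proof.
move=> M0 acF [A [mA A0 NA]] s t s0 st tT.
apply/ler_addgt0Pr => e' e'0.
have T1 : 0 < (t - s) + 1 by rewrite ltr_wpDl// subr_ge0.
(* The errors [e (t - s)] from the slopes and [e] from absolute continuity add up to [e']. *)
pose e := e' / ((t - s) + 1).
have e0 : 0 < e by rewrite divr_gt0.
have [del del0 Hdel] := acF e e0.
have [V [oV AV]] := outer_measure_open_le A (divr_gt0 del0 (ltr0Sn R 1)).
rewrite [X in (_ <= X + _)%E]A0 add0e => Vdel.
have mV : measurable (V : set (measurableTypeR R)) by exact: open_measurable.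
(* The invariant of the induction: finitely many nonoverlapping intervals in [[s, x]], their length
   charged to the part of [V] before [x] and their increments paid for separately from the slope
   [M + e]. *)
pose Good (x : R) := exists l : seq (R * R), [/\
  all (fun p => [&& s <= p.1, p.1 <= p.2 & p.2 <= x]) l,
  pairwise apart l,
  ((\sum_(p <- l) (p.2 - p.1))%:E <= @lebesgue_measure R (V `&` `]s, x]))%E &
  `|F x - F s| <= (M + e) * (x - s) + \sum_(p <- l) `|F p.2 - F p.1|].
have Good_le x y l : x <= y -> all (fun p => [&& s <= p.1,
  p.1 <= p.2 & p.2 <= x]) l ->
    all (fun p : R * R => [&& s <= p.1, p.1 <= p.2 & p.2 <= y]) l.
  move=> xy; apply: sub_all => p /and3P[-> -> px] /=; exact: le_trans xy.
have Goods : Good s.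
  exists [::]; split => //; first by rewrite big_nil measure_ge0.
  by rewrite !subrr normr0 big_nil mulr0 addr0.
(* Goodness passes across [x], from any [a] shortly before to any [b] shortly after: by one more
   interval inside [V] if [x] is exceptional, otherwise by comparing both ends with [F x]. *)
have gauge x : s <= x -> x <= t -> exists2 eta : R, 0 < eta &
    forall a b, s <= a -> a <= x -> x <= b -> x - eta < a -> b < x + eta ->
    Good a -> Good b.
  move=> sx xt; have [Ax|Ax] := pselect (A x).
    have /nbhs_ballP[eta /= eta0 Heta] : nbhs x V by apply: open_nbhs_nbhs;
      split => //; exact: AV.
    exists eta => // a b sa ax xb aeta beta [l [al pl ml Fl]].
    have abV y : a < y -> y <= b -> V y.
      move=> ay yb; apply: Heta; rewrite /ball/= ltr_norml.
      by apply/andP; split; move: ax xb aeta beta ay yb; clear; lra.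
    have ab := le_trans ax xb.
    exists ((a, b) :: l); split.
    - by rewrite /= sa ab lexx/=; exact: Good_le al.
    - rewrite /= pl andbT; apply: sub_all al => p /and3P[_ _ pa].
      by rewrite /apart/= pa orbT.
    - rewrite big_cons/= EFinD.
      have -> : V `&` `]s, b]%classic = (V `&` `]s, a]%classic) `|` `]a, b]%classic.
        apply/seteqP; split => y /=; rewrite !in_itv/=.
          by move=> [Vy /andP[sy yb]]; case: (leP y a) => ya; [left;
            split => //; rewrite sy|right].
        move=> [[Vy /andP[sy ya]]|/andP[ay yb]]; first by split => //;
          rewrite sy (le_trans ya).
        by split; [exact: abV|rewrite (le_lt_trans sa)].
      have mVsa : measurable (V `&` `]s, a]%classic : set (measurableTypeR R)).
        by apply: measurableI => //; exact: measurable_itv.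
      have mab : measurable (`]a, b]%classic : set (measurableTypeR R)).
        exact: measurable_itv.
      have dab : (V `&` `]s, a]%classic) `&` `]a, b]%classic = set0.
        apply/seteqP; split => y //= [[_]]; rewrite !in_itv/= => /andP[_ ya]
          /andP[ay _].
        by move: (le_lt_trans ya ay); rewrite ltxx.
      rewrite (measureU (@lebesgue_measure R) mVsa mab dab).
      suff lab : ((b - a)%:E <= @lebesgue_measure R `]a, b]%classic)%E.
        by rewrite addeC; apply: leeD; [exact: ml|exact: lab].
      rewrite lebesgue_measure_itv/= lte_fin.
      by case: ltP => // ba; rewrite lee_fin subr_le0.
    - rewrite big_cons/=; have : `|F b - F s| <= `|F b - F a| + `|F a - F s|.
        by rewrite [X in `|X| <= _](_ : _ = (F b - F a) + (F a - F s))
          ?ler_normD//; ring.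
      move=> /le_trans; apply; rewrite [leRHS]addrCA lerD2l.
      apply: (le_trans Fl); rewrite lerD2r ler_wpM2l ?lerD2r//.
      by rewrite addr_ge0// ltW.
  have [l [dF dl] lM] : exists2 l, is_derive x (1 : R) F l & `|l| <= M.
    apply: contrapT => H; apply/Ax/NA => /= H'; apply/H/H'.
    by rewrite in_itv/= (le_trans s0)//= (le_trans xt).
  have : h^-1 *: (F (h *: (1 : R) + x) - F x) @[h --> 0^'] --> l by rewrite -dl.
  move=> /(@cvgrPdist_lt _ R^o)/(_ e e0)/nbhs_ballP[eta /= eta0 Heta].
  have slope y : `|y - x| < eta -> `|F y - F x| <= (M + e) * `|y - x|.
    move=> yx; have [->|yxn] := eqVneq y x; first by rewrite !subrr normr0 mulr0.
    have yx0 : y - x != 0 by rewrite subr_eq0.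
    have := Heta (y - x); rewrite /ball/= sub0r normrN => /(_ yx yx0).
    rewrite /GRing.scale/= mulr1 subrK distrC => H.
    have : `|(y - x)^-1 * (F y - F x)| <= M + e.
      rewrite -[X in `|X|](subrK l); apply: (le_trans (ler_normD _ _)).
      by rewrite addrC; apply: lerD => //; exact: ltW.
    by rewrite normrM normfV ler_pdivrMl ?normr_gt0// mulrC.
  exists eta => // a b sa ax xb aeta beta [L [al pl ml Fl]].
  have ab := le_trans ax xb.
  exists L; split => //.
  - exact: Good_le al.
  - apply: le_trans ml _; apply: le_measure; rewrite ?inE.
    + by apply: measurableI => //; exact: measurable_itv.
    + by apply: measurableI => //; exact: measurable_itv.
    + move=> y /= [Vy]; rewrite !in_itv/= => /andP[sy ya]; split => //.
      by rewrite sy (le_trans ya).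
  - have := slope b; have := slope a.
    rewrite (ger0_norm (_ : 0 <= b - x)) ?subr_ge0// (ler0_norm (_ : a - x <=
      0)) ?subr_le0//.
    have -> : - (a - x) < eta by rewrite opprB ltrBlDr -ltrBlDl.
    have -> : b - x < eta by rewrite ltrBlDl.
    move=> /(_ isT) Ha /(_ isT) Hb.
    have : `|F b - F s| <= `|F b - F x| + (`|F a - F x| + `|F a - F s|).
      rewrite [X in `|X| <= _](_ : _ = (F b - F x) + (- (F a - F x) + (F a - F
        s))); last by ring.
      by apply: (le_trans (ler_normD _ _)); rewrite lerD2l -(normrN (F a - F x))
        ler_normD.
    move=> /le_trans; apply; move: Ha Hb Fl; clear; lra.
(* Good points approach the supremum of [S], and the gauge there leads either to [t] or to a good
   point beyond the supremum, which is absurd. *)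
pose S := [set x | [/\ s <= x, x <= t & Good x]].
have supS : has_sup S.
  by split; [exists s; split|exists t => x []].
have Sc x : S x -> x <= sup S by apply: ub_le_sup; case: supS.
have sc : s <= sup S by apply: Sc; split.
have ct : sup S <= t by apply: sup_le_ub; [case: supS|move=> x []].
have [eta eta0 Heta] := gauge _ sc ct.
have [x [sx xt Gx] etax] := sup_adherent eta0 supS.
have Goodt : Good t.
  have eta2 : 0 < eta / 2 by rewrite divr_gt0.
  have eta2' : eta / 2 < eta by rewrite ltr_pdivrMr// ltr_pMr// ltr1n.
  have Sx : x <= sup S by exact: Sc.
  have cle : sup S <= sup S + eta / 2 by rewrite lerDl ltW.
  have clt : sup S + eta / 2 < sup S + eta by rewrite ltrD2l.
  have [tc|/ltW ct'] := leP t (sup S + eta / 2).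
    exact: (Heta x t sx Sx ct etax (le_lt_trans tc clt) Gx).
  have : S (sup S + eta / 2).
    split; [exact: le_trans sc cle|exact: ct'|].
    exact: (Heta x _ sx Sx cle etax clt Gx).
  by move=> /Sc; rewrite gerDl leNgt eta2.
have [l [al pl ml Fl]] := Goodt.
have suml : \sum_(p <- l) (p.2 - p.1) < del.
  rewrite -lte_fin; apply: (le_lt_trans ml); apply: (@le_lt_trans _ _
    (@lebesgue_measure R V)).
    apply: le_measure; rewrite ?inE//.
    by apply: measurableI => //; exact: measurable_itv.
  by apply: (le_lt_trans Vdel); rewrite lte_fin ltr_pdivrMr// ltr_pMr// ltr1n.
have sumF : \sum_(p <- l) `|F p.2 - F p.1| < e.
  have := Hdel (size l) (fun i => (nth (0, 0) l i).1) (fun i => (nth (0, 0) l i).2).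
  rewrite !(big_nth (0, 0)) !big_mkord in suml *; apply => //.
  - move=> i; have /(allP al)/and3P[sp pp pt] := mem_nth (0, 0) (ltn_ord i).
    by split => //; [exact: le_trans sp|exact: le_trans tT].
  - move/pairwiseP : pl => /(_ (0, 0)) pl.
    have H (i j : 'I_(size l)) : (i < j)%N -> apart (nth (0, 0) l i) (nth (0,
      0) l j).
      by move=> ij; apply: pl; rewrite ?inE.
    move=> i j; rewrite -val_eqE neq_ltn => /orP[/H|/H] /orP[]; by [left|right].
apply: (le_trans Fl); apply: (le_trans (lerD (lexx _) (ltW sumF))).
rewrite mulrDl -addrA lerD2l -{2}(mulr1 e) -mulrDr /e.
by rewrite mulfVK ?gt_eqF.
Qed.

End absolutely_continuous_lipschitz.

(** * Selection principles *)

Section selection.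
Context {R : realType}.

Lemma ultra_bounded_cvg (F : set_system nat) (w : nat -> R) (B : R) :
  UltraFilter F -> (forall k, `|w k| <= B) ->
  exists l : R, w k @[k --> F] --> l.
Proof.
move=> UF wB; have PF := @ultra_proper _ _ UF.
have wBB : F (w @^-1` `[- B, B]%classic).
  by apply: filterE => k; rewrite /= in_itv/= -ler_norml.
have [l [_ cl]] := @segment_compact R (- B) B _ (fmap_proper_filter w PF) wBB.
exists l => N Nl; have [//|FN] := in_ultra_setVsetC (w @^-1` N) UF.
by have [x []] := cl (~` N) N FN Nl.
Qed.

(* An ultrafilter finer than \oo gives a limit at every index at once; a
   subsequence is then extracted for countably many indices only. *)
Lemma pointwise_selection (J : Type) (I : countType) (D : I -> J)
    (w : nat -> J -> R) (B : R) : (forall k j, `|w k j| <= B) ->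
  exists (F : set_system nat) (l : J -> R) (s : nat -> nat),
    [/\ ProperFilter F, forall j, w k j @[k --> F] --> l j,
        forall k, (k <= s k)%N &
        forall i, w (s k) (D i) @[k --> \oo] --> l (D i)].
Proof.
move=> wB; have [F [UF Foo]] := ultraFilterLemma eventually_filter.
have PF := @ultra_proper _ _ UF.
have [l lE] := choice (fun j => ultra_bounded_cvg UF (wB ^~ j)).
(* Diagonal choice: the index picked for [k] serves the finitely many [i] of code at most [k], with
   tolerance 1/(k+1). *)
have good k : exists m, (k <= m)%N /\ forall i, (pickle i <= k)%N ->
    `|l (D i) - w m (D i)| < k.+1%:R^-1.
  pose P n m := oapp (fun i => `|l (D i) - w m (D i)| < k.+1%:R^-1) true
    (unpickle n).
  have FP n : \forall m \near F, P n m.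
    rewrite /P; case: (unpickle n) => [i|] /=; last exact: nearW.
    by have := lE (D i) => /(@cvgrPdist_lt _ R^o); apply; rewrite invr_gt0.
  have FPn n : \forall m \near F, forall j, (j < n)%N -> P j m.
    elim: n => [|n IH]; first exact: nearW.
    apply: filterS2 IH (FP n) => m IH Pnm j.
    by rewrite ltnS leq_eqVlt => /predU1P[->|/IH].
  have Fk : F [set m | (k <= m)%N] by apply: Foo; exists k.
  have [m [km Pm]] := filter_ex (filterI Fk (FPn k.+1)).
  by exists m; split => // i ik; have := Pm (pickle i) ik; rewrite /P pickleK.
have [s /all_and2[sk sP]] := choice good.
exists F, l, s; split => // i; apply/(@cvgrPdist_lt _ R^o) => e e0.
near=> k; apply: (lt_trans (sP k i _)).
  by near: k; exact: nbhs_infty_ge.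
by near: k; exact: (near_infty_natSinv_lt (PosNum e0)).
Unshelve. all: by end_near. Qed.

End selection.

Section euclidean_norm.
Context {R : realType} {n : nat}.
Implicit Types v w : 'rV[R]_n.

Lemma dot_ge0 v : 0 <= dot v v.
Proof. by apply: sumr_ge0 => i _; rewrite -expr2 sqr_ge0. Qed.

Lemma coord_le_enorm v i : `|v ord0 i| <= enorm v.
Proof.
rewrite -sqrtr_sqr; apply: ler_wsqrtr.
by rewrite /dot (bigD1 i)//= expr2 lerDl; apply: sumr_ge0 => j _;
  rewrite -expr2 sqr_ge0.
Qed.

Lemma enorm_le_sum v : enorm v <= \sum_i `|v ord0 i|.
Proof.
rewrite -[leRHS]ger0_norm ?sumr_ge0// -sqrtr_sqr; apply: ler_wsqrtr.
rewrite expr2 big_distrl/=; apply: ler_sum => i _.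
rewrite -expr2 -real_normK ?num_real// expr2 ler_wpM2l//.
by rewrite (bigD1 i)//= lerDl sumr_ge0.
Qed.

Lemma cvg_enorm (F : set_system nat) (v_ : nat -> 'rV[R]_n) v : ProperFilter F ->
  (forall i, v_ k ord0 i @[k --> F] --> v ord0 i) ->
  enorm (v_ k) @[k --> F] --> enorm v.
Proof.
move=> PF vi.
have D : dot (v_ k) (v_ k) @[k --> F] --> dot v v.
  by apply: cvg_big => [|i _]; [exact: add_continuous|apply: cvgM; exact: vi].
have S := @sqrt_continuous R (dot v v).
exact: (@cvg_comp _ _ _ (fun k => dot (v_ k) (v_ k)) _ F _ _ D S).
Qed.

End euclidean_norm.

(** * Helly's selection theorem *)

Section helly.
Context {R : realType}.

(** A monotone function has one-sided limits, and they coincide away from the jumps; rational points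
    close to [t] on either side then have nearly equal values. *)
Lemma nondecreasing_jump (a b t e : R) (V : R -> R) :
  {in `[a, b] &, {homo V : x y / x <= y}} -> t \in `]a, b[ ->
  ~ discontinuity V t -> 0 < e ->
  exists p q : rat, [/\ a <= ratr p, ratr p < t, t < ratr q, ratr q <= b &
    V (ratr q) - V (ratr p) < e].
Proof.
move=> ndV; rewrite in_itv/= => /andP[at_ tb] dV e0.
have cl : cvg (V x @[x --> t^'-]).
  apply: nondecreasing_at_left_is_cvgr; near=> x.
    move=> y z; rewrite !in_itv/= => /andP[xy yt] /andP[xz zt] yz.
    have ax : a <= x by near: x; exact: nbhs_left_ge.
    by apply: ndV => //; rewrite in_itv/=; apply/andP; split; lra.
  exists (V t) => _ [y + <-]; rewrite /= in_itv/= => /andP[xy yt].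
  have ax : a <= x by near: x; exact: nbhs_left_ge.
  by apply: ndV; rewrite ?in_itv/= ?(ltW yt)//; apply/andP; split; lra.
have cr : cvg (V x @[x --> t^'+]).
  apply: nondecreasing_at_right_is_cvgr; near=> x.
    move=> y z; rewrite !in_itv/= => /andP[xy yt] /andP[xz zt] yz.
    have ax : x <= b by near: x; exact: nbhs_right_le.
    by apply: ndV => //; rewrite in_itv/=; apply/andP; split; lra.
  exists (V t) => _ [y + <-]; rewrite /= in_itv/= => /andP[xy yt].
  have ax : x <= b by near: x; exact: nbhs_right_le.
  by apply: ndV; rewrite ?in_itv/= ?(ltW xy)//; apply/andP; split; lra.
have lr : lim (V x @[x --> t^'-]) = lim (V x @[x --> t^'+]).
  by apply/eqP; apply: contra_notT dV => ?; split.
have e2 : 0 < e / 2 by rewrite divr_gt0.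
have [x [ax xt Vx]] : exists x, [/\ a < x, x < t & `|lim (V x @[x -->
  t^'-]) - V x| < e / 2].
  near t^'- => x; exists x; split.
  - by near: x; exact: nbhs_left_gt.
  - by near: x; exact: nbhs_left_lt.
  - by near: x; move: cl => /(@cvgrPdist_lt _ R^o); apply.
have [y [ty yb Vy]] : exists y, [/\ t < y, y < b & `|lim (V x @[x -->
  t^'+]) - V y| < e / 2].
  near t^'+ => y; exists y; split.
  - by near: y; exact: nbhs_right_gt.
  - by near: y; exact: nbhs_right_lt.
  - by near: y; move: cr => /(@cvgrPdist_lt _ R^o); apply.
have [p] := rat_in_itvoo xt; rewrite in_itv/= => /andP[xp pt].
have [q] := rat_in_itvoo ty; rewrite in_itv/= => /andP[tq qy].
exists p, q; split => //; [lra|lra|].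
have in_ab z : a <= z -> z <= b -> z \in `[a, b] by rewrite in_itv/= => -> ->.
have Vqy : V (ratr q) <= V y by apply: ndV (ltW qy); apply: in_ab; lra.
have Vxp : V x <= V (ratr p) by apply: ndV (ltW xp); apply: in_ab; lra.
move: Vx Vy; rewrite lr !ltr_norml => /andP[? ?] /andP[? ?]; lra.
Unshelve. all: by end_near. Qed.

Lemma total_variation_le_etotal d (a b : R) (u : R -> 'rV[R]_d) (i : 'I_d) :
  (total_variation a b (fun t => u t ord0 i) <= etotal_variation a b u)%E.
Proof.
apply: ge_ereal_sup => _ [_ [s /= abs <-] <-].
apply: (@le_trans _ _ (evariation a b u s)%:E); last first.
  by apply: ereal_sup_ubound; exists s.
rewrite lee_fin; apply: ler_sum => k _ /=.
by have := coord_le_enorm (u (nth b s k) - u (nth b (a :: s) k)) i; rewrite !mxE.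
Qed.

Lemma leb_ae_forall_ord d (P : 'I_d -> R -> Prop) :
  (forall i, \forall t \ae leb R, P i t) -> \forall t \ae leb R, forall i, P i t.
Proof.
move=> aeP.
have : \forall t \ae leb R, forall k, forall i : 'I_d, i = k :> nat -> P i t.
  apply: ae_foralln => k; have [kd|dk] := ltnP k d.
    apply: filterS (aeP (Ordinal kd)) => t Pt i ik.
    by rewrite (_ : i = Ordinal kd)//; exact/val_inj.
  by apply: nearW => t i ik; move: (ltn_ord i); rewrite ik ltnNge dk.
by apply: filterS => t Pt i; exact: (Pt i i).
Qed.

(* V_k is the variation function of a component of u_k; the convergence may only
   fail at the countably many discontinuities of the limit of the V_k. *)
Lemma helly_selection d (T K B : R) (u_ : nat -> R -> 'rV[R]_d) : 0 < T ->
  (forall k, (etotal_variation 0 T (u_ k) <= K%:E)%E) ->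
  (forall k t i, t \in `[0, T] -> `|u_ k t ord0 i| <= B) ->
  exists (u : R -> 'rV[R]_d) (s : nat -> nat),
    [/\ (etotal_variation 0 T u <= K%:E)%E, (forall k, (k <= s k)%N),
        (forall t i, t \in `[0, T] -> `|u t ord0 i| <= B) &
        \forall t \ae leb R, t \in `[(0 : R), T] ->
          forall i, u_ (s k) t ord0 i @[k --> \oo] --> u t ord0 i].
Proof.
move=> T0 tvu uB.
have T0' := ltW T0.
pose c k i t := u_ k t ord0 i.
pose V k i t := fine (total_variation 0 t (c k i)).
have tvT k i : (total_variation 0 T (c k i) <= K%:E)%E.
  by apply: le_trans (tvu k); exact: total_variation_le_etotal.
have tvfin k i t : t \in `[0, T] -> total_variation 0 t (c k i) \is a fin_num.
  rewrite in_itv/= => /andP[t0 tT]; rewrite ge0_fin_numE;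
    last exact: total_variation_ge0.
  apply: (@le_lt_trans _ _ K%:E); last exact: ltry.
  by apply: le_trans (tvT k i); apply: (total_variation_nondecreasing (a := 0)
    (b := T)) => //;
    rewrite in_itv/= ?t0 ?lexx ?T0'.
have VK k i t : t \in `[0, T] -> 0 <= V k i t <= K.
  move=> tT; have := tvfin k i t tT; move: tT; rewrite in_itv/= => /andP[t0 tT] fin.
  apply/andP; split; first by apply: fine_ge0; exact: total_variation_ge0.
  rewrite -lee_fin fineK//; apply: le_trans (tvT k i).
  by apply: (total_variation_nondecreasing (a := 0) (b := T)) => //;
    rewrite in_itv/= ?t0 ?lexx ?T0'.
have cV k i s t : 0 <= s -> s <= t -> t <= T ->
  `|c k i t - c k i s| <= V k i t - V k i s.
  move=> s0 st tT.
  have finS : total_variation 0 s (c k i) \is a fin_num by apply: tvfin;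
    rewrite in_itv/= s0 (le_trans st).
  have finT : total_variation 0 t (c k i) \is a fin_num by apply: tvfin;
    rewrite in_itv/= tT (le_trans s0).
  have D := total_variationD (c k i) s0 st.
  have finD : total_variation s t (c k i) \is a fin_num.
    by move: finT; rewrite D fin_numD => /andP[].
  rewrite /V D fineD// addrAC subrr add0r -lee_fin fineK//.
  exact: total_variation_ge.
(* The boolean selects a component of the control or its variation up to the given time, so that a
   single selection yields limits of both along the same indices. *)
pose w k (j : R * 'I_d * bool) :=
  let t := clamp T j.1.1 in if j.2 then c k j.1.2 t else V k j.1.2 t.
pose D (j : rat * 'I_d * bool) : R * 'I_d * bool := (ratr j.1.1, j.1.2, j.2).
have wB k j : `|w k j| <= `|B| + `|K|.
  rewrite /w; have cT := clamp_itv j.1.1 T0'; case: ifP => _.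
    by apply: (le_trans (uB k _ j.1.2 cT)); apply: (le_trans (ler_norm _));
      rewrite lerDl.
  have /andP[V0 VK'] := VK k j.1.2 _ cT; rewrite ger0_norm//.
  by apply: (le_trans VK'); apply: (le_trans (ler_norm _)); rewrite lerDr.
have [F [l [s [PF lF sk ls]]]] := pointwise_selection D wB.
pose u t : 'rV[R]_d := \row_i l (t, i, true).
pose W i t := l (t, i, false).
have cF i t : t \in `[0, T] -> c k i t @[k --> F] --> u t ord0 i.
  by move=> tT; have := lF (t, i, true); rewrite /w/= clampE// mxE.
have VF i t : t \in `[0, T] -> V k i t @[k --> F] --> W i t.
  by move=> tT; have := lF (t, i, false); rewrite /w/= clampE.
have uW i x y : 0 <= x -> x <= y -> y <= T ->
    `|u y ord0 i - u x ord0 i| <= W i y - W i x.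
  move=> x0 xy yT.
  have xT : x \in `[0, T] by rewrite in_itv/= x0 (le_trans xy).
  have yT' : y \in `[0, T] by rewrite in_itv/= yT (le_trans x0).
  have H1 : `|c k i y - c k i x| @[k --> F] --> `|u y ord0 i - u x ord0 i|.
    by apply: cvg_norm; apply: cvgB; exact: cF.
  have H2 : V k i y - V k i x @[k --> F] --> W i y - W i x.
    by apply: cvgB; exact: VF.
  apply: (ler_cvg_to H1 H2); apply: nearW => k; exact: cV.
have ndW i : {in `[0, T] &, {homo W i : x y / x <= y}}.
  move=> x y; rewrite !in_itv/= => /andP[x0 xT] /andP[y0 yT] xy.
  by rewrite -subr_ge0; apply: le_trans (uW i x y x0 xy yT).
exists u, s; split => //.
(* At the arbitrary points of a partition only the limit along [F] is available. It suffices, since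
   the sum over one partition is continuous in the values. *)
- apply: ge_ereal_sup => _ [p /= abp <-]; rewrite lee_fin.
  have H : evariation 0 T (u_ k) p @[k --> F] --> evariation 0 T u p.
    have nT m : (m <= size p)%N -> nth T (0 :: p) m \in `[0, T].
      move=> mp; rewrite in_itv/= (itv_partition_nth_le _ abp)// andbT.
      exact: itv_partition_nth_ge abp.
    rewrite /evariation [X in _ --> X]big_nat.
    under eq_fun do rewrite big_nat.
    apply: cvg_big => [|m /andP[_ mp]]; first exact: add_continuous.
    apply: cvg_enorm => i.
    have -> : (fun k => (((u_ k \o nth T (0 :: p)) m.+1 - (u_ k \o nth T (0 ::
      p)) m)
        : 'rV[R]_d) ord0 i) =
        (fun k => c k i (nth T (0 :: p) m.+1) - c k i (nth T (0 :: p) m)).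
      by apply/funext => k; rewrite !mxE.
    have -> : (((u \o nth T (0 :: p)) m.+1 - (u \o nth T (0 :: p)) m)
        : 'rV[R]_d) ord0 i =
        u (nth T (0 :: p) m.+1) ord0 i - u (nth T (0 :: p) m) ord0 i.
      by rewrite !mxE.
    by apply: cvgB; apply: cF; apply: nT; rewrite // ltnW.
  apply: (cvgr_to_le H); apply: nearW => k; rewrite -lee_fin.
  by apply: le_trans (tvu k); apply: ereal_sup_ubound; exists p.
- move=> t i tT; apply: (cvgr_to_le (cvg_norm (cF i t tT))).
  by apply: nearW => k; exact: uB.
have cont i : \forall t \ae leb R, ~ ((t \in `]0, T[) /\ discontinuity (W i) t).
  have cW := discontinuity_countable (ndW i).
  exists [set t | (t \in `]0, T[) /\ discontinuity (W i) t]; split.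
  - apply: borel_lebT; apply: (countable_measurable _ cW) => t.
    exact: measurable_set1.
  - exact: (countable_lebesgue_measure0 cW).
  - by move=> t /= /contrapT.
apply: leb_ae_itvcc; apply: filterS (leb_ae_forall_ord cont) => t Wt tT i.
apply/(@cvgrPdist_lt _ R^o) => e e0.
(* The comparison goes through the rational [q] to the right of [t]. The limit moves by at most
   [W q - W p] between [t] and [q], and [c (s k) i] by at most the same difference of [V (s k) i],
   which costs two more errors, at [p] and [q]. With the error of [c] at [q], five sevenths of [e]
   accumulate. *)
have e7 : 0 < e / 7 by rewrite divr_gt0.
have dWt : ~ discontinuity (W i) t by move=> dW; apply: (Wt i).
have [p [q [p0 pt tq qT Wpq]]] := nondecreasing_jump (ndW i) tT dWt e7.
move: tT; rewrite in_itv/= => /andP[t0 tT].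
have pT : ratr p \in `[0, T] by rewrite in_itv/= p0/=; lra.
have qT' : ratr q \in `[0, T] by rewrite in_itv/= qT andbT; lra.
have cq : c (s k) i (ratr q) @[k --> \oo] --> u (ratr q) ord0 i.
  by have := ls (q, i, true); rewrite /w/= clampE// mxE.
have Vq : V (s k) i (ratr q) @[k --> \oo] --> W i (ratr q).
  by have := ls (q, i, false); rewrite /w/= clampE.
have Vp : V (s k) i (ratr p) @[k --> \oo] --> W i (ratr p).
  by have := ls (p, i, false); rewrite /w/= clampE.
near=> k.
have H1 : `|u (ratr q) ord0 i - c (s k) i (ratr q)| < e / 7.
  by near: k; move: cq => /(@cvgrPdist_lt _ R^o); apply.
have H2 : `|W i (ratr q) - V (s k) i (ratr q)| < e / 7.
  by near: k; move: Vq => /(@cvgrPdist_lt _ R^o); apply.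
have H3 : `|W i (ratr p) - V (s k) i (ratr p)| < e / 7.
  by near: k; move: Vp => /(@cvgrPdist_lt _ R^o); apply.
have H4 := cV (s k) i _ _ (ltW t0) (ltW tq) qT.
have H5 := uW i _ _ (ltW t0) (ltW tq) qT.
have H6 := cV (s k) i _ _ p0 (ltW pt) (ltW tT).
have H7 : W i (ratr p) <= W i t.
  by apply: ndW (ltW pt) => //; rewrite in_itv/= !ltW.
have H8 := le_trans (normr_ge0 _) H6.
rewrite -/(c (s k) i t); move: H1 H2 H3 H4 H5 H7 H8 Wpq; clear.
rewrite !ltr_norml !ler_norml.
move=> /andP[? ?] /andP[? ?] /andP[? ?] /andP[? ?] /andP[? ?] ? ? ?.
by apply/andP; split; lra.
Unshelve. all: by end_near. Qed.

End helly.

(** * Superposition *)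

Section superposition.
Context {R : realType}.

(** Setting all functions to 0 on a null set makes the convergence hold everywhere; completeness of
    [leb R] brings the measurability back to [f]. *)
Lemma ae_cvg_measurable (a b : R) (h_ : nat -> R -> R) (f : R -> R) :
  (forall m, measurable_fun (`[a, b] : set (lebT R)) (h_ m : lebT R -> R)) ->
  (\forall t \ae leb R, t \in `[a, b] -> h_ m t @[m --> \oo] --> f t) ->
  measurable_fun (`[a, b] : set (lebT R)) (f : lebT R -> R).
Proof.
move=> mh [A [mA A0 NA]].
have mAb : measurable_fun (`[a, b] : set (lebT R)) (fun t : lebT R => t \in A).
  apply: (measurable_fun_bool true).
  rewrite (_ : _ @^-1` _ = A); first exact: measurableI.
  by apply/seteqP; split => t /= => [/set_mem|/mem_set].
have mf0 : measurable_fun (`[a, b] : set (lebT R))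
    (fun t : lebT R => if t \in A then 0 else f t).
  apply: (@measurable_fun_cvg _ (lebT R) R _ (fun m t => if t \in A then 0 else
    h_ m t)).
    move=> m; apply: measurable_fun_if => //.
    by apply: measurable_funS (mh m) => // t [].
  move=> t tab; case: ifPn => [_|tA]; first exact: cvg_cst.
  apply: contrapT => H; move/negP: tA; apply; apply/mem_set/NA => /= H'.
  exact/H/H'.
apply: lebT_ae_measurable mf0; exists A; split => // t /= tA.
by apply: contrapT => At; apply: tA => _; rewrite memNset.
Qed.

(** The l1 distance: a sum over coordinates, so it is measurable in time when [p] is, and it
    dominates the max norm that defines the topology. *)
Definition sdist n (p q : 'rV[R]_n) : R := \sum_i `|p ord0 i - q ord0 i|.

Lemma ball_sdist n (p q : 'rV[R]_n) e : 0 < e -> sdist p q < e -> ball p e q.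
Proof.
move=> e0 pqe; split => // i j; rewrite /ball/= (ord1 i); apply: le_lt_trans pqe.
by rewrite /sdist (bigD1 j)//= lerDl sumr_ge0.
Qed.

Lemma cvg_rV (F : set_system nat) n (p_ : nat ->
  'rV[R]_n) (p : 'rV[R]_n) : Filter F ->
  (forall i, p_ k ord0 i @[k --> F] --> p ord0 i) -> p_ k @[k --> F] --> p.
Proof.
move=> FF pi; apply/cvg_ballP => e e0.
have : \forall k \near F, forall i, `|p ord0 i - p_ k ord0 i| < e.
  by apply: filter_forall => i; move: (pi i) => /(@cvgrPdist_lt _ R^o); apply.
by apply: filterS => k H; split => // i j; rewrite /ball/= (ord1 i).
Qed.

Lemma compact_net n (A : set 'rV[R]_n) (e : R) : compact A -> 0 < e ->
  exists l : seq 'rV[R]_n, (forall c, c \in l -> A c) /\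
    forall p, A p -> exists2 c, c \in l & sdist p c < e.
Proof.
rewrite compact_cover => cA e0.
have n1 : 0 < n%:R + 1 :> R by rewrite ltr_wpDl.
(* Balls are those of the max norm: [n] coordinates, each within [e / (n + 1)], sum to less than
   [e], also for [n = 0]. *)
have d0 : 0 < e / (n%:R + 1) by rewrite divr_gt0.
have [|p Ap|l lA Al] := cA _ A (fun c => (ball c (e / (n%:R + 1)))^°).
- by move=> c _; exact: open_interior.
- by exists p => //; exact: nbhsx_ballx.
exists (finmap.enum_fset l); split => [c cl|p /Al[c /= cl /interior_subset pc]].
  by have := lA c cl; rewrite inE.
exists c => //; apply: (@le_lt_trans _ _ (\sum_(i < n) (e / (n%:R + 1)))).
  apply: ler_sum => i _; rewrite distrC ltW//.
  exact: pc.2 ord0 i.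
rewrite sumr_const card_ord -[_ *+ n]mulr_natr mulrAC ltr_pdivrMr// ltr_pM2l//.
by rewrite ltrDl.
Qed.

Lemma within_cvg_seq (T : topologicalType) (A : set T) (f : T -> R) (p : T)
    (z : nat -> T) : {within A, continuous f} -> A p ->
  (\forall k \near \oo, A (z k)) -> z k @[k --> \oo] --> p ->
  f (z k) @[k --> \oo] --> f p.
Proof.
move=> /subspace_continuousP cf Ap Az zp.
have zA : z k @[k --> \oo] --> within A (nbhs p).
  by move=> N /= pN; apply: filterS2 Az (zp _ pN) => k Azk; apply.
have fA : f x @[x --> within A (nbhs p)] --> f p by exact: cf.
exact: (@cvg_comp _ _ _ z f _ _ _ zA fA).
Qed.

(* Replace (x t, u t) by the first point of a finite net of C `*` U close to it:
   the resulting function of t is piecewise of the form g t c v. *)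
Lemma superposition_measurable n d (C : set 'rV[R]_n) (U : set 'rV[R]_d) (T : R)
    (g : R -> 'rV[R]_n -> 'rV[R]_d -> R) (x : R -> 'rV[R]_n) (u : R -> 'rV[R]_d) :
  compact C -> compact U ->
  (forall c v, U v -> measurable_fun (`[0, T] : set (lebT R)) (fun t : lebT R =>
    g t c v)) ->
  (forall t, t \in `[0, T] ->
    {within [set: 'rV[R]_n] `*` U, continuous (fun p => g t p.1 p.2)}) ->
  measurable_on T x -> measurable_on T u ->
  (forall t, t \in `[0, T] -> C (x t)) ->
  (\forall t \ae leb R, t \in `[(0 : R), T] -> U (u t)) ->
  measurable_fun (`[0, T] : set (lebT R)) (fun t : lebT R => g t (x t) (u t)).
Proof.
move=> cC cU mg cg mx mu xC uU.
have e0 m : 0 < m.+1%:R^-1 :> R by rewrite invr_gt0.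
have [lC lCP] := choice (fun m => compact_net cC (e0 m)).
have [lU lUP] := choice (fun m => compact_net cU (e0 m)).
pose close m t (cv : 'rV[R]_n * 'rV[R]_d) :=
  (sdist (x t) cv.1 < m.+1%:R^-1) && (sdist (u t) cv.2 < m.+1%:R^-1).
(* The default 0 is not reached on the list [L m] when [x t] is in [C] and [u t] is in [U], since
   the nets come close to every such pair. *)
pose sel m t := foldr (fun cv acc => if close m t cv then g t cv.1 cv.2 else acc) 0.
pose L m := [seq (c, v) | c <- lC m, v <- lU m].
have msdist k (y : R -> 'rV[R]_k) (p : 'rV[R]_k) : measurable_on T y ->
    measurable_fun (`[0, T] : set (lebT R)) (fun t : lebT R => sdist (y t) p).
  move=> my.
  apply: (@measurable_sum _ (lebT R) R _ _ _ (fun i t => `|y t ord0 i - p ord0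
    i|)) => i.
  have mB : measurable_fun (`[0, T] : set (lebT R))
      (fun t : lebT R => y t ord0 i - p ord0 i).
    exact: measurable_funB (my i) (measurable_cst _).
  exact: measurableT_comp (@normr_measurable R setT) mB.
have mclose m cv : measurable_fun (`[0, T] : set (lebT R)) (fun t : lebT R =>
  close m t cv).
  apply: measurable_and.
    exact: measurable_fun_ltr (msdist _ _ _ mx) (measurable_cst _).
  exact: measurable_fun_ltr (msdist _ _ _ mu) (measurable_cst _).
have msel m l : (forall cv, cv \in l -> U cv.2) ->
    measurable_fun (`[0, T] : set (lebT R)) (fun t : lebT R => sel m t l).
  elim: l => [|cv l IH] lU'; first exact: measurable_cst.
  have Ucv : U cv.2 by apply: lU'; rewrite mem_head.
  have Ul cv' : cv' \in l -> U cv'.2.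
    by move=> cvl; apply: lU'; rewrite in_cons cvl orbT.
  apply: (measurable_fun_if (measurable_lebT_itv _) (mclose m cv)).
    by apply: measurable_funS (mg cv.1 cv.2 Ucv);
      [exact: measurable_lebT_itv|move=> t []].
  by apply: measurable_funS (IH Ul); [exact: measurable_lebT_itv|move=> t []].
have selP m t l : (exists2 cv, cv \in l & close m t cv) ->
    exists2 cv, cv \in l & close m t cv /\ sel m t l = g t cv.1 cv.2.
  elim: l => [[]//|cv l IH] [cv' cvl' ccv'] /=; case: ifPn => [ccv|ncv].
    by exists cv; rewrite ?mem_head.
  have [|cv2 cvl2 H] := IH.
    exists cv' => //; move: cvl'; rewrite in_cons => /predU1P[E|//].
    by move: ncv; rewrite -E ccv'.
  by exists cv2; rewrite // in_cons cvl2 orbT.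
apply: (@ae_cvg_measurable 0 T (fun m t => sel m t (L m))).
  move=> m; apply: msel => cv /allpairsP[[c v] /= [_ vl ->]] /=.
  exact: (lUP m).1.
apply: filterS uU => t uU tT; have {uU}Uu := uU tT; have Cx := xC t tT.
have zP m : exists cv, [/\ U cv.2, close m t cv & sel m t (L m) = g t cv.1 cv.2].
  have [c cl cx] := (lCP m).2 _ Cx; have [v vl vu] := (lUP m).2 _ Uu.
  have [|[c' v'] /allpairsP[[c2 v2] /= [_ vl2 [_ ->]]] [clo E]] := selP m t (L m).
    by exists (c, v); rewrite /close ?cx ?vu//; apply/allpairsP; exists (c, v).
  by exists (c', v2); split => //; exact: (lUP m).1.
have [z /all_and3[Uz cz Ez]] := choice zP.
have -> : (fun m => sel m t (L m)) = (fun m => (fun p => g t p.1 p.2) (z m)).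
  by apply/funext => m; rewrite Ez.
apply: (within_cvg_seq (cg t tT) (p := (x t, u t))) => //.
  by apply: nearW => m; split => //; exact: Uz.
apply/cvg_ballP => e e1; near=> m.
have me : m.+1%:R^-1 < e by near: m; exact: (near_infty_natSinv_lt (PosNum e1)).
have /andP[c1 c2] := cz m.
by split; apply: ball_sdist => //; [apply: lt_trans c1 me|apply: lt_trans c2 me].
Unshelve. all: by end_near. Qed.

End superposition.

(** * Velocities of processes *)

Section process_velocity.
Context {R : realType}.

Lemma leb_ae_exists (a b : R) (P : R -> Prop) : a < b ->
  (\forall t \ae leb R, P t) -> exists2 t, t \in `[a, b] & P t.
Proof.
move=> ab [A [mA A0 PA]]; apply: contrapT => H.
have abA : `[a, b]%classic `<=` A.
  by move=> t tab; apply: PA => /= Pt; apply: H; exists t.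
have : (leb R `[a, b]%classic <= leb R A)%E.
  by apply: le_measure; rewrite ?inE//; exact: measurable_lebT_itv.
by rewrite A0 (leb_itvcc (ltW ab)) leNgt lte_fin subr_gt0 ab.
Qed.

Lemma is_derive_sumr n (F : 'I_n -> R -> R) (l : 'I_n -> R) (t : R) :
  (forall i, is_derive t (1 : R) (F i) (l i)) ->
  is_derive t (1 : R) (fun s => \sum_i F i s) (\sum_i l i).
Proof.
move=> dF; have -> : (fun s => \sum_i F i s) = \sum_i F i.
  by apply/funext => s; rewrite fct_sumE.
exact: is_derive_sum.
Qed.

(** [v] is orthogonal to [w - v], so this is Pythagoras. *)
Lemma dot_projection_le n (v w : 'rV[R]_n) : dot v v = dot w v ->
  dot v v <= dot w w.
Proof.
move=> vw; have := dot_ge0 (w - v).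
have -> : dot (w - v) (w - v) = dot w w - dot w v - (dot w v - dot v v).
  rewrite /dot -!sumrB; apply: eq_bigr => i _; rewrite !mxE; ring.
by rewrite -vw subrr subr0 subr_ge0.
Qed.

Lemma absolutely_continuous_dist T n (x : R -> 'rV[R]_n) (e : R) :
  absolutely_continuous_on T x -> 0 < e -> exists2 del, 0 < del &
    forall s t, 0 <= s -> s <= t -> t <= T -> t - s < del -> enorm (x t - x s) < e.
Proof.
move=> acx e0; have [del del0 H] := acx e e0; exists del => // s t s0 st tT tsd.
have := H 1%N (fun=> s) (fun=> t); rewrite !big_ord1; apply => //.
by move=> i j; rewrite (ord1 i) (ord1 j) eqxx.
Qed.

(** Near any time of [[0, T]] there is an interval of positive length, hence a time at which the
    state lies in [C]; continuity and closedness conclude. *)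
Lemma absolutely_continuous_closed T n (x : R -> 'rV[R]_n) (C : set 'rV[R]_n) :
  0 < T -> closed C -> absolutely_continuous_on T x ->
  (\forall t \ae leb R, t \in `[(0 : R), T] -> C (x t)) ->
  forall t, t \in `[0, T] -> C (x t).
Proof.
move=> T0 cC acx xC t; rewrite in_itv/= => /andP[t0 tT];
  apply: cC => N /nbhs_ballP[e /= e0 eN].
have [del del0 Hdel] := absolutely_continuous_dist acx e0.
pose a := Num.max 0 (t - del / 2); pose b := Num.min T (t + del / 2).
have d2 : 0 < del / 2 by rewrite divr_gt0.
have ab : a < b.
  rewrite /a /b gt_max !lt_min T0/=; apply/andP; split; first by lra.
  by apply/andP; split; lra.
have [s] := leb_ae_exists ab xC; rewrite !in_itv/= /a /b ge_max le_min.
move=> /andP[/andP[s0 ts] /andP[sT st]]; rewrite s0 sT => /(_ isT) Cs.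
exists (x s); split => //; apply: eN; split => // i j.
rewrite (ord1 i) /ball/=; have [tles|/ltW slet] := leP t s.
  apply: (@le_lt_trans _ _ (enorm (x s - x t))); last by apply: Hdel => //; lra.
  by rewrite distrC; have := coord_le_enorm (x s - x t) j; rewrite !mxE.
apply: (@le_lt_trans _ _ (enorm (x t - x s))); last by apply: Hdel => //; lra.
by have := coord_le_enorm (x t - x s) j; rewrite !mxE.
Qed.

Lemma absolutely_continuous_coord T n (x : R -> 'rV[R]_n) (j : 'I_n) :
  absolutely_continuous_on T x ->
  forall e : R, 0 < e -> exists2 del : R, 0 < del &
    forall (m : nat) (a b : 'I_m -> R),
      (forall i, [/\ 0 <= a i, a i <= b i & b i <= T]) ->
      (forall i j, i != j -> b i <= a j \/ b j <= a i) ->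
      \sum_(i < m) (b i - a i) < del ->
      \sum_(i < m) `|x (b i) ord0 j - x (a i) ord0 j| < e.
Proof.
move=> acx e e0; have [del del0 H] := acx e e0; exists del => // m a b ab dis sm.
apply: le_lt_trans (H m a b ab dis sm); apply: ler_sum => i _.
by have := coord_le_enorm (x (b i) - x (a i)) j; rewrite !mxE.
Qed.

(* The velocity x' is orthogonal to the normal vector v = g - x', because
   s |-> <v, x s> is maximal at t; hence |x'|^2 = <g, x'> and |x'| <= |g|. *)
Lemma process_velocity n d (C : set 'rV[R]_n) (U : set 'rV[R]_d) (T M : R)
    (g : R -> 'rV[R]_n -> 'rV[R]_d -> 'rV[R]_n) (x : R -> 'rV[R]_n) (u : R ->
      'rV[R]_d) :
  closed C -> 0 < T -> 0 <= M ->
  (forall t x u, t \in `[0, T] -> U u -> enorm (g t x u) <= M) ->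
  process C U T g x u ->
  [/\ forall t, t \in `[0, T] -> C (x t),
      forall i, lipschitz M (fun t => x (clamp T t) ord0 i) &
      exists h : 'I_n -> R -> R,
        [/\ forall i, measurable_fun setT (h i), forall i t, `|h i t| <= M,
          forall i, \forall t \ae leb R, t \in `[(0 : R), T] ->
            is_derive t (1 : R) (fun s => x (clamp T s) ord0 i) (h i t) &
          \forall t \ae leb R, t \in `[(0 : R), T] ->
            [/\ U (u t), forall i, derive1 x t ord0 i = h i t,
              forall y, C y ->
                \sum_i (g t (x t) (u t) ord0 i - h i t) * (y ord0 i - x t ord0
                  i) <= 0 &
              \sum_i h i t * h i t = \sum_i g t (x t) (u t) ord0 i * h i t]]].
Proof.
move=> cC T0 M0 gM [[mu acx] dx Uu _ _].
have oc t : t \in `]0, T[ -> t \in `[0, T].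
  by rewrite !in_itv/= => /andP[? ?]; rewrite !ltW.
have xC : forall t, t \in `[0, T] -> C (x t).
  apply: (absolutely_continuous_closed T0 cC acx).
  by apply: filterS dx => t H tT; have [_ [v [Cx _] _]] := H tT.
(* Restricted to interior times, because the derivative vanishes at a maximum only if both sides are
   accessible. *)
have key : \forall t \ae leb R, t \in `](0 : R), T[ ->
    [/\ forall i, is_derive t (1 : R) (fun s => x s ord0 i) (derive1 x t ord0 i),
      U (u t), exists2 v, normal_cone C (x t) v & derive1 x t = - v + g t (x t)
        (u t) &
      dot (derive1 x t) (derive1 x t) = dot (g t (x t) (u t)) (derive1 x t)].
  move: dx Uu; apply: filterS2 => t dx Uu tT.
  have [derx [v Nv xv]] := dx (oc t tT); have Ut := Uu (oc t tT).
  have dxi i : is_derive t (1 : R) (fun s => x s ord0 i) (derive1 x t ord0 i).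
    split; first by have /derivable_mxP := derx; apply.
    by rewrite derive1E (derive_mx derx) mxE.
  split => //; first by exists v.
  have vx0 : dot v (derive1 x t) = 0.
    have dphi : is_derive t (1 : R) (fun s => dot v (x s)) (dot v (derive1 x t)).
      by apply: is_derive_sumr => i; exact: (is_deriveZ (v ord0 i) (dxi i)).
    apply: (is_derive_max tT dphi) => s sT.
    rewrite -subr_le0; have [_ /(_ _ (xC s sT))] := Nv; apply: le_trans.
    by rewrite /dot -sumrB; apply: ler_sum => i _; rewrite !mxE mulrBr.
  transitivity (dot (- v + g t (x t) (u t)) (derive1 x t)); first by rewrite -xv.
  rewrite -[RHS]subr0 -vx0 /dot -sumrB; apply: eq_bigr => i _.
  by rewrite !mxE; ring.
have lx i : lipschitz M (fun t => x (clamp T t) ord0 i).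
  have Mx : forall s t, 0 <= s -> s <= t -> t <= T ->
    `|x t ord0 i - x s ord0 i| <= M * (t - s).
    apply: (absolutely_continuous_lipschitz (F := fun t => x t ord0 i) M0
      (absolutely_continuous_coord i acx)).
    apply: leb_ae_itvcc; apply: filterS key => t H tT; have [dxi Ut _ xx] := H tT.
    exists (derive1 x t ord0 i) => //; apply: (le_trans (coord_le_enorm _ _)).
    apply: le_trans (gM t (x t) (u t) (oc t tT) Ut).
    by apply: ler_wsqrtr; exact: dot_projection_le.
  move=> s t; have := clamp_itv t (ltW T0); have := clamp_itv s (ltW T0);
    rewrite !in_itv/=.
  move=> /andP[s0 sT] /andP[t0 tT]; apply: (@le_trans _ _ (M * `|clamp T s -
    clamp T t|)); last first.
    by rewrite ler_wpM2l// clamp_dist.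
  have [st|/ltW ts] := leP (clamp T s) (clamp T t).
    by rewrite distrC (distrC (clamp T s)) (ger0_norm (_ : 0 <= clamp T t - _))
      ?subr_ge0//; exact: Mx.
  by rewrite (ger0_norm (_ : 0 <= clamp T s - _)) ?subr_ge0//; exact: Mx.
split => //.
(* [derive1 x] is controlled almost everywhere only; [h] is a Borel version of the velocity that is
   bounded by [M] at every time. *)
have [h hP] := choice (fun i => lipschitz_derivative T0 (lx i)).
exists h; split.
- by move=> i; case: (hP i).
- by move=> i; case: (hP i).
- by move=> i; case: (hP i).
have dh : \forall t \ae leb R, forall i, t \in `[(0 : R), T] ->
    is_derive t (1 : R) (fun s => x (clamp T s) ord0 i) (h i t).
  by apply: leb_ae_forall_ord => i; case: (hP i).
apply: leb_ae_itvcc; move: key dh; apply: filterS2 => t key dh tT.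
have [dxi Ut [v [_ Nv] xv] xx] := key tT.
have xh i : derive1 x t ord0 i = h i t.
  apply: is_derive_unique (dxi i) _.
  exact: (iffLR (is_derive_clamp (fun s => x s ord0 i) _ tT) (dh i (oc t tT))).
split => //.
- move=> y Cy; apply: le_trans (Nv y Cy); apply: ler_sum => i _.
  by rewrite -xh xv !mxE opprD opprK addrCA subrr addr0.
- by under eq_bigr do rewrite -xh; under [RHS]eq_bigr do rewrite -xh.
Qed.

End process_velocity.

(** * Strong-weak limits and the Arzela-Ascoli theorem *)

Section compactness.
Context {R : realType}.
Implicit Types (a b L T B M : R).

Lemma Rintegral_sum a b n (F : 'I_n -> R -> R) :
  (forall i, bounded_measurable a b (F i)) ->
  \int[leb R]_(t in `[a, b]) (\sum_i F i t) = \sum_i \int[leb R]_(t in `[a,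
    b]) F i t.
Proof.
move=> bF; elim: (index_enum _) => [|i s IH].
  rewrite big_nil; under eq_Rintegral do rewrite big_nil.
  by rewrite Rintegral_cst// mul0r.
rewrite big_cons -IH -RintegralD//; last 2 first.
- exact: bounded_measurable_integrable.
- by apply: bounded_measurable_integrable; exact: bounded_measurable_sum.
by apply: eq_Rintegral => t _; rewrite big_cons.
Qed.

Lemma Rintegral_patch a b c d (p : R -> R) : a <= c -> d <= b ->
  \int[leb R]_(t in `[a, b]) ((p \_ `[c, d]) t) = \int[leb R]_(t in `[c, d]) p t.
Proof.
move=> ac db; rewrite -Rintegral_mkcondr; congr (Rintegral _ _ _).
apply/seteqP; split => t /=; first by move=> [].
rewrite !in_itv/= => /andP[ct td]; split; last by rewrite ct td.
by rewrite (le_trans ac)// (le_trans td).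
Qed.

(** [p_ k] splits into [p_ k - p], which tends to 0 boundedly against the bounded [h_ k], and the
    fixed function [p], against which the derivatives converge weakly. *)
Lemma strong_weak_cvg T L B a b (p_ : nat -> R -> R) (p : R -> R)
    (q_ : nat -> R -> R) (q : R -> R) (h_ : nat -> R -> R) (h : R -> R) :
  0 < T -> 0 <= a -> b <= T ->
  (forall k, measurable_fun (`[0, T] : set (lebT R)) (p_ k : lebT R -> R)) ->
  (forall k t, t \in `[0, T] -> `|p_ k t| <= B) -> bounded_measurable 0 T p ->
  (\forall t \ae leb R, t \in `[(0 : R), T] -> p_ k t @[k --> \oo] --> p t) ->
  (forall k, lipschitz L (q_ k)) -> lipschitz L q ->
  (forall t, t \in `[0, T] -> q_ k t @[k --> \oo] --> q t) ->
  (forall k, measurable_fun (`[0, T] : set (lebT R)) (h_ k : lebT R -> R)) ->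
  (forall k t, `|h_ k t| <= L) -> bounded_measurable 0 T h ->
  (forall k, \forall t \ae leb R, t \in `[(0 : R), T] ->
    is_derive t (1 : R) (q_ k) (h_ k t)) ->
  (\forall t \ae leb R, t \in `[(0 : R), T] -> is_derive t (1 : R) q (h t)) ->
  (\int[leb R]_(t in `[a, b]) (p_ k t * h_ k t))%R @[k --> \oo] -->
  \int[leb R]_(t in `[a, b]) (p t * h t).
Proof.
move=> T0 a0 bT mp_ p_B bp p_p lq_ lq q_q mh_ hL bh dq_ dq.
have L0 := lipschitz_ge0 lq.
have bp_ k : bounded_measurable 0 T (p_ k).
  by split => //; exists B; exact: p_B.
have bh_ k : bounded_measurable 0 T (h_ k).
  by split => //; exists L => t _; exact: hL.
have sub t : t \in `[a, b] -> t \in `[0, T].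
  rewrite !in_itv/= => /andP[at_ tb].
  by rewrite (le_trans a0 at_) (le_trans tb bT).
have weak : (\int[leb R]_(t in `[a, b]) (p t * h_ k t))%R @[k --> \oo] -->
    \int[leb R]_(t in `[a, b]) (p t * h t).
  (* The interval is absorbed into the test function by cutting [p] off outside [[a, b]]. *)
  have E f : \int[leb R]_(t in `[a, b]) (p t * f t) =
      \int[leb R]_(t in `[0, T]) ((p \_ `[a, b]) t * f t).
    rewrite -(Rintegral_patch _ a0 bT); apply: eq_Rintegral => t _.
    by rewrite !patchE; case: ifP => // _; rewrite mul0r.
  rewrite E; under eq_fun do rewrite E.
  exact: (Rintegral_derivative_cvg T0 (bounded_measurable_patch a0 bT bp) lq_ lq).
have strong : (\int[leb R]_(t in `[a, b]) ((p_ k t - p t) * h_ k t))%R @[k -->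
  \oo] -->
    \int[leb R]_(t in `[a, b]) 0.
  have [Bp pB] := bp.2.
  apply: (@bounded_Rintegral_cvg _ a b (fun k t => (p_ k t - p t) * h_ k t)
    (fun=> 0)
    ((B + Bp) * L)).
  - move=> k; have [m _] := bounded_measurableM (bounded_measurableB (bp_ k) bp)
    (bh_ k).
    by apply: measurable_funS m => //; exact: sub.
  - move=> k; apply: nearW => t /sub tT; rewrite normrM; apply: ler_pM => //.
    by apply: (le_trans (ler_normB _ _)); apply: lerD; [exact: p_B|exact: pB].
  - exact: measurable_cst.
  - apply: filterS p_p => t p_p /sub tT.
    have : `|p_ k t - p t| * L @[k --> \oo] --> (0 : R).
      rewrite -[X in _ --> X](mul0r L) -(normr0 R) -(subrr (p t)).
      by apply: cvgM; [apply: cvg_norm; apply: cvgB;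
        [exact: p_p|exact: cvg_cst]|exact: cvg_cst].
    move=> H; apply: norm_cvg0; apply: (squeeze_cvgr _ (cvg_cst 0) H).
    by apply: nearW => k; rewrite normr_ge0 normrM/= ler_wpM2l.
rewrite Rintegral_cst// mul0r in strong.
have bab f : bounded_measurable 0 T f -> bounded_measurable a b f.
  by move=> bf; exact: bounded_measurableS bf.
have E k : \int[leb R]_(t in `[a, b]) ((p_ k t - p t) * h_ k t) +
    \int[leb R]_(t in `[a, b]) (p t * h_ k t) =
    \int[leb R]_(t in `[a, b]) (p_ k t * h_ k t).
  rewrite -RintegralD//.
  - by apply: eq_Rintegral => t _; ring.
  - apply: bounded_measurable_integrable; apply: bab.
    exact: (bounded_measurableM (bounded_measurableB (bp_ k) bp) (bh_ k)).
  - by apply: bounded_measurable_integrable; apply: bab; exact: bounded_measurableM.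
rewrite -[X in _ --> X]add0r.
apply: cvg_trans (cvgD strong weak); apply: near_eq_cvg; apply: nearW => k.
exact: (E k).
Qed.

(** The limit along the filter exists at all times and inherits the Lipschitz constant. A
    subsequence that converges at rational times converges to it everywhere, because all functions
    share this constant. *)
Lemma lipschitz_selection n T M B (x_ : nat -> R -> 'rV[R]_n) : 0 < T ->
  (forall k i, lipschitz M (fun t => x_ k (clamp T t) ord0 i)) ->
  (forall k t i, t \in `[0, T] -> `|x_ k t ord0 i| <= B) ->
  exists (x : R -> 'rV[R]_n) (s : nat -> nat),
    [/\ (forall k, (k <= s k)%N), (forall i, lipschitz M (fun t => x t ord0 i)),
        (forall t, x (clamp T t) = x t) &
        forall t i, t \in `[0, T] -> x_ (s k) t ord0 i @[k --> \oo] --> x t ord0 i].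
Proof.
move=> T0 lx xB; have T0' := ltW T0.
pose w k (j : R * 'I_n) := x_ k (clamp T j.1) ord0 j.2.
pose D (j : rat * 'I_n) : R * 'I_n := (ratr j.1, j.2).
have wB k j : `|w k j| <= B by apply: xB; exact: clamp_itv.
have [F [l [s [PF lF sk ls]]]] := pointwise_selection D wB.
pose x t : 'rV[R]_n := \row_i l (clamp T t, i).
have cc t : clamp T (clamp T t) = clamp T t by rewrite clampE// clamp_itv.
have xE i t : x_ k (clamp T t) ord0 i @[k --> F] --> x t ord0 i.
  by have := lF (clamp T t, i); rewrite /w/= cc mxE.
have xl i : lipschitz M (fun t => x t ord0 i).
  move=> a b; apply: (cvgr_to_le (cvg_norm (cvgB (xE i a) (xE i b)))).
  by apply: nearW => k; exact: lx.
exists x, s; split => // [t|t i tT].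
  by apply/rowP => i; rewrite !mxE cc.
have M0 : 0 <= M by exact: lipschitz_ge0 (lx 0%N i).
apply/(@cvgrPdist_lt _ R^o) => e e0.
have d0 : 0 < e / 3 / (M + 1) by rewrite !divr_gt0// ltr_wpDl.
(* Nothing keeps [q] below [T]; this is harmless since all functions involved are clamped. *)
have [q] : exists q : rat, ratr q \in `]t, (t + e / 3 / (M + 1))[.
  by apply: rat_in_itvoo; rewrite ltrDl.
rewrite in_itv/= => /andP[tq qt].
have Mtq : M * `|t - ratr q| < e / 3.
  rewrite ler0_norm ?subr_le0 ?ltW// opprB.
  apply: (@le_lt_trans _ _ (M * (e / 3 / (M + 1)))).
    by rewrite ler_wpM2l// lerBlDl ltW.
  by rewrite mulrCA gtr_pMr ?divr_gt0// ltr_pdivrMr ?ltr_wpDl// mul1r ltrDl.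
have cq : x_ (s k) (clamp T (ratr q)) ord0 i @[k --> \oo] --> x (ratr q) ord0 i.
  have := ls (q, i); rewrite /w/=.
  suff -> : l (D (q, i)) = x (ratr q) ord0 i by [].
  exact: (cvg_unique (@Rhausdorff R) (lF (ratr q, i)) (xE i (ratr q))).
near=> k.
have H1 : `|x (ratr q) ord0 i - x_ (s k) (clamp T (ratr q)) ord0 i| < e / 3.
  by near: k; move: cq => /(@cvgrPdist_lt _ R^o); apply; rewrite divr_gt0.
have H2 := xl i t (ratr q); have H3 := lx (s k) i t (ratr q);
  rewrite /= clampE// in H3.
move: H1 (le_lt_trans H2 Mtq) (le_lt_trans H3 Mtq); clear; rewrite !ltr_norml.
by move=> /andP[? ?] /andP[? ?] /andP[? ?]; apply/andP; split; lra.
Unshelve. all: by end_near. Qed.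

End compactness.

(** * Limits of processes *)

Section limit_process.
Context {R : realType} {n d : nat}.
Context (C : set 'rV[R]_n) (U : set 'rV[R]_d) (T M : R).
Context (g : R -> 'rV[R]_n -> 'rV[R]_d -> 'rV[R]_n).
Context (cC : compact C) (cU : compact U) (T0 : 0 < T) (M0 : 0 <= M).
Context (mg : forall x u, U u -> measurable_on T (fun t => g t x u)).
Context (cg : forall t, t \in `[0, T] ->
  {within [set: 'rV[R]_n] `*` U, continuous (fun p => g t p.1 p.2)}).
Context (gM : forall t x u, t \in `[0, T] -> U u -> enorm (g t x u) <= M).

Let closedC : closed C.
Proof. by apply: compact_closed => //; exact: norm_hausdorff. Qed.

Lemma compact_coord_bounded m (A : set 'rV[R]_m) : compact A ->
  exists B, forall c i, A c -> `|c ord0 i| <= B.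
Proof.
move=> /compact_bounded/pinfty_ex_gt0 [B _ HB]; exists B => c i Ac.
apply: le_trans (HB c Ac); rewrite [leRHS]/Num.Def.normr/= mx_normrE.
exact: (le_bigmax _ _ (ord0, i)).
Qed.

(* The bound |g| <= M only holds where u t is in U, hence the truncation. *)
Definition drift (x : R -> 'rV[R]_n) (u : R -> 'rV[R]_d) (i : 'I_n) (t : R) : R :=
  Num.max (- M) (Num.min M (g t (x t) (u t) ord0 i)).

Lemma drift_le x u i t : `|drift x u i t| <= M.
Proof. rewrite ler_norml /drift le_max lexx/= ge_max ge_min lexx/= andbT.
by rewrite (le_trans _ M0)// oppr_le0.
Qed.

Lemma driftE x u i t : t \in `[0, T] -> U (u t) ->
  drift x u i t = g t (x t) (u t) ord0 i.
Proof.
move=> tT Ut; have := le_trans (coord_le_enorm _ i) (gM (x t) tT Ut).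
by rewrite ler_norml => /andP[? ?]; rewrite /drift min_r// max_r.
Qed.

Let cgi t i : t \in `[0, T] ->
  {within [set: 'rV[R]_n] `*` U, continuous (fun p => g t p.1 p.2 ord0 i)}.
Proof.
move=> tT; apply/subspace_continuousP => p Ap.
have /subspace_continuousP/(_ p Ap) H := cg tT.
have D := @coord_continuous R 1 n ord0 i (g t p.1 p.2).
have {}H : g t q.1 q.2 @[q --> within ([set: 'rV[R]_n] `*` U) (nbhs p)] -->
  nbhs (g t p.1 p.2) by exact: H.
exact: (@cvg_comp _ _ _ (fun q => g t q.1 q.2) (fun v : 'rV[R]_n => v ord0 i)
  _ _ _ H D).
Qed.

Lemma bounded_measurable_drift x u i : measurable_on T x -> measurable_on T u ->
  (forall t, t \in `[0, T] -> C (x t)) ->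
  (\forall t \ae leb R, t \in `[(0 : R), T] -> U (u t)) ->
  bounded_measurable 0 T (drift x u i).
Proof.
move=> mx mu xC uU; split; last by exists M => t _; exact: drift_le.
apply: measurable_maxr; first exact: measurable_cst.
apply: measurable_minr; first exact: measurable_cst.
apply: (@superposition_measurable R n d C U T (fun t x u => g t x u ord0 i) x u
  cC cU _ _ mx mu xC uU).
- by move=> c v Uv; exact: mg.
- by move=> t tT; exact: cgi.
Qed.

Lemma lipschitz_measurable_on m (x : R -> 'rV[R]_m) :
  (forall i, lipschitz M (fun t => x (clamp T t) ord0 i)) -> measurable_on T x.
Proof.
move=> lx i; have := @lebT_continuous_measurable R 0 T _ (lipschitz_continuous
  (lx i)).
apply: lebT_ae_measurable; apply: nearW => t tT.
by rewrite clampE.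
Qed.

Lemma drift_cvg (x_ : nat -> R -> 'rV[R]_n) (u_ : nat -> R -> 'rV[R]_d)
    (x : R -> 'rV[R]_n) (u : R -> 'rV[R]_d) i :
  (forall k, \forall t \ae leb R, t \in `[(0 : R), T] -> U (u_ k t)) ->
  (\forall t \ae leb R, t \in `[(0 : R), T] -> U (u t)) ->
  (forall t i, t \in `[0, T] -> x_ k t ord0 i @[k --> \oo] --> x t ord0 i) ->
  (\forall t \ae leb R, t \in `[(0 : R), T] ->
    forall i, u_ k t ord0 i @[k --> \oo] --> u t ord0 i) ->
  \forall t \ae leb R, t \in `[(0 : R), T] ->
    drift (x_ k) (u_ k) i t @[k --> \oo] --> drift x u i t.
Proof.
move=> /ae_foralln uU_ uU x_x u_u.
move: uU_ uU u_u; apply: filterS3 => t Uk Ut ut tT.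
rewrite driftE//; last exact: Ut.
have -> : (fun k => drift (x_ k) (u_ k) i t) =
    (fun k => (fun p => g t p.1 p.2 ord0 i) (x_ k t, u_ k t)).
  by apply/funext => k; rewrite driftE//; exact: Uk.
apply: (@within_cvg_seq R _ ([set: 'rV[R]_n] `*` U) (fun p => g t p.1 p.2 ord0 i)
  (x t, u t) (fun k => (x_ k t, u_ k t)) (cgi tT)).
- by split => //; exact: Ut.
- by apply: nearW => k; split => //; exact: Uk.
- have cx : x_ k t @[k --> \oo] --> x t by apply: cvg_rV => j; exact: x_x.
  have cu : u_ k t @[k --> \oo] --> u t by apply: cvg_rV => j; exact: ut.
  exact: (cvg_pair cx cu).
Qed.

Lemma limit_dynamics (x_ : nat -> R -> 'rV[R]_n) (u_ : nat -> R -> 'rV[R]_d)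
    (x : R -> 'rV[R]_n) (u : R -> 'rV[R]_d) :
  (forall k, process C U T g (x_ k) (u_ k)) ->
  (forall i, lipschitz M (fun t => x t ord0 i)) ->
  (forall t i, t \in `[0, T] -> x_ k t ord0 i @[k --> \oo] --> x t ord0 i) ->
  measurable_on T u ->
  (\forall t \ae leb R, t \in `[(0 : R), T] -> U (u t)) ->
  (\forall t \ae leb R, t \in `[(0 : R), T] ->
    forall i, u_ k t ord0 i @[k --> \oo] --> u t ord0 i) ->
  \forall t \ae leb R, t \in `[(0 : R), T] ->
    derivable x t 1 /\
    exists2 v, normal_cone C (x t) v & derive1 x t = - v + g t (x t) (u t).
Proof.
move=> pr lx x_x mu uU u_u.
have facts k := process_velocity closedC T0 M0 gM (pr k).
have lx_ k i : lipschitz M (fun t => x_ k (clamp T t) ord0 i) by case: (facts k).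
have xC_ k t : t \in `[0, T] -> C (x_ k t) by case: (facts k) => + _ _; apply.
have [h_ hP] := choice (fun k => let: And3 _ _ H := facts k in H).
have uU_ k : \forall t \ae leb R, t \in `[(0 : R), T] -> U (u_ k t) by case: (pr k).
have mu_ k : measurable_on T (u_ k) by case: (pr k) => -[].
have xC t : t \in `[0, T] -> C (x t).
  move=> tT; have cx : x_ k t @[k --> \oo] --> x t.
    by apply: cvg_rV => j; exact: x_x.
  apply: (@closed_cvg _ _ _ _ (fun k => x_ k t) C closedC _ (x t) cx).
  by apply: nearW => k; exact: xC_.
have mx : measurable_on T x.
  by apply: lipschitz_measurable_on => i; exact: lipschitz_clamp (lx i).
have mx_ k := lipschitz_measurable_on (lx_ k).
have bG i : bounded_measurable 0 T (drift x u i) by exact: bounded_measurable_drift.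
have bG_ k i : bounded_measurable 0 T (drift (x_ k) (u_ k) i).
  by apply: bounded_measurable_drift => //; exact: xC_.
have G_G i := drift_cvg i uU_ uU x_x u_u.
have [h hhP] := choice (fun i => lipschitz_derivative T0 (lx i)).
have bh i : bounded_measurable 0 T (h i).
  have [mh hM _ _] := hhP i.
  by split; [apply: borel_lebT_fun => //; exact: measurable_funTS|exists M].
have [B HB] := compact_coord_bounded cC.
have bx i : bounded_measurable 0 T (fun t => x t ord0 i).
  by split; [exact: mx|exists B => t tT; exact: HB (xC t tT)].
have bx_ k i : bounded_measurable 0 T (fun t => x_ k t ord0 i).
  by split; [exact: mx_|exists B => t tT; exact: HB (xC_ k t tT)].
have bh_ k i : bounded_measurable 0 T (h_ k i).
  have [mh hM _ _] := hP k.
  by split; [apply: borel_lebT_fun => //; exact: measurable_funTS|exists M].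
(* [A] is the candidate for the normal vector and [Q y] its scalar product with [y - x]. *)
pose A i t := drift x u i t - h i t.
have bA i : bounded_measurable 0 T (A i) by exact: bounded_measurableB.
pose Q (y : 'rV[R]_n) t := \sum_i A i t * (y ord0 i - x t ord0 i).
have ineq y a b : C y -> 0 <= a -> a <= b -> b <= T ->
    \int[leb R]_(t in `[a, b]) Q y t <= 0.
  move=> Cy a0 ab bT.
  have sub t : t \in `[a, b] -> t \in `[0, T].
    rewrite !in_itv/= => /andP[at_ tb].
    by rewrite (le_trans a0 at_) (le_trans tb bT).
  have by_ i : bounded_measurable 0 T (fun t => y ord0 i - x t ord0 i).
    by apply: bounded_measurableB => //; exact: bounded_measurable_cst.
  have by_k k i : bounded_measurable 0 T (fun t => y ord0 i - x_ k t ord0 i).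
    by apply: bounded_measurableB => //; exact: bounded_measurable_cst.
  have bab f : bounded_measurable 0 T f -> bounded_measurable a b f.
    by move=> bf; exact: bounded_measurableS bf.
  pose Q_ k t := \sum_i (drift (x_ k) (u_ k) i t - h_ k i t) * (y ord0 i - x_ k
    t ord0 i).
  have bQ_ k : bounded_measurable 0 T (Q_ k).
    exact: (bounded_measurable_sum _ (fun i =>
      bounded_measurableM (bounded_measurableB (bG_ k i) (bh_ k i)) (by_k k i))).
  have Q_le0 k : \int[leb R]_(t in `[a, b]) Q_ k t <= 0.
    rewrite [leRHS](_ : _ = \int[leb R]_(t in `[a, b]) 0); last first.
      by rewrite Rintegral_cst// mul0r.
    apply: Rintegral_ae_le; [exact: bab|exact: bounded_measurable_cst|].
    have [_ _ _] := hP k; apply: filterS => t H /sub tT.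
    have [Ut _ /(_ y Cy) + _] := H tT; apply: le_trans.
    by apply: ler_sum => i _; rewrite driftE.
  (* Separates the products of strongly convergent factors from those that contain a velocity, which
     converges only weakly. *)
  have E (G H : 'I_n -> R -> R) (z : R -> 'rV[R]_n) :
      (forall i, bounded_measurable 0 T (G i)) ->
        (forall i, bounded_measurable 0 T (H i)) ->
      (forall i, bounded_measurable 0 T (fun t => y ord0 i - z t ord0 i)) ->
      \int[leb R]_(t in `[a, b]) (\sum_i (G i t - H i t) * (y ord0 i - z t ord0
        i)) =
      \sum_i (\int[leb R]_(t in `[a, b]) (G i t * (y ord0 i - z t ord0 i)) -
              \int[leb R]_(t in `[a, b]) ((y ord0 i - z t ord0 i) * H i t)).
    move=> bG' bH bz; rewrite Rintegral_sum; last first.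
      move=> i; apply: bab.
      exact: (bounded_measurableM (bounded_measurableB (bG' i) (bH i)) (bz i)).
    apply: eq_bigr => i _; rewrite -RintegralB//.
    - by apply: eq_Rintegral => t _; ring.
    - exact: (bounded_measurable_integrable (bab _ (bounded_measurableM (bG' i)
      (bz i)))).
    - exact: (bounded_measurable_integrable (bab _ (bounded_measurableM (bz i)
      (bH i)))).
  suff H : \int[leb R]_(t in `[a, b]) Q_ k t @[k --> \oo] -->
    \int[leb R]_(t in `[a, b]) Q y t.
    by apply: (cvgr_to_le H); apply: nearW => k; exact: Q_le0.
  rewrite [X in _ --> X]E//.
  suff H : (\sum_i (\int[leb R]_(t in `[a, b]) (drift (x_ k) (u_ k) i t * (y
    ord0 i - x_ k t ord0 i)) -
      \int[leb R]_(t in `[a, b]) ((y ord0 i - x_ k t ord0 i) * h_ k i t))) @[k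
        --> \oo] -->
      \sum_i (\int[leb R]_(t in `[a, b]) (drift x u i t * (y ord0 i - x t ord0 i)) -
        \int[leb R]_(t in `[a, b]) ((y ord0 i - x t ord0 i) * h i t)).
    by apply: cvg_trans H; apply: near_eq_cvg; apply: nearW => k; rewrite /Q_ E.
  apply: cvg_big => [|i _]; first exact: add_continuous.
  have yB t (z : R -> 'rV[R]_n) : C (z t) -> `|y ord0 i - z t ord0 i| <= B + B.
    by move=> Cz; apply: (le_trans (ler_normB _ _)); apply: lerD; exact: HB.
  apply: cvgB.
    apply: (@bounded_Rintegral_cvg _ a b
      (fun k t => drift (x_ k) (u_ k) i t * (y ord0 i - x_ k t ord0 i)) _ (M *
        (B + B))).
    - by move=> k; case: (bab _ (bounded_measurableM (bG_ k i) (by_k k i))).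
    - move=> k; apply: nearW => t /sub tT; rewrite normrM; apply: ler_pM => //.
        exact: drift_le.
      by apply: yB; exact: xC_.
    - by case: (bab _ (bounded_measurableM (bG i) (by_ i))).
    - apply: filterS (G_G i) => t Gt /sub tT; apply: cvgM; first exact: Gt.
      by apply: cvgB; [exact: cvg_cst|exact: x_x].
  apply: (@strong_weak_cvg _ T M (B + B) a b (fun k t => y ord0 i - x_ k t ord0 i) _
    (fun k t => x_ k (clamp T t) ord0 i) (fun t => x t ord0 i) _ _ T0 a0 bT _ _
      (by_ i)
    _ (fun k => lx_ k i) (lx i) _ _ _ (bh i)).
  - by move=> k; case: (by_k k i).
  - by move=> k t tT; apply: yB; exact: xC_.
  - by apply: nearW => t tT; apply: cvgB; [exact: cvg_cst|exact: x_x].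
  - by move=> t tT; rewrite clampE//; exact: x_x.
  - by move=> k; case: (bh_ k i).
  - by move=> k; have [] := hP k.
  - by move=> k; have [] := hP k.
  - by have [] := hhP i.
(* [Q y] is affine in [y], so it is enough to differentiate the primitives of the [A i] and of one
   further function. The exceptional null set is therefore the same for all [y]. *)
have dA : \forall t \ae leb R, forall i, t \in `[(0 : R), T] ->
    is_derive t (1 : R) (fun s => \int[leb R]_(r in `[0, s]) A i r) (A i t).
  by apply: leb_ae_forall_ord => i; exact: primitive_is_derive.
have bAx : bounded_measurable 0 T (fun t => \sum_i A i t * x t ord0 i).
  by apply: bounded_measurable_sum => i; exact: bounded_measurableM.
have dx : \forall t \ae leb R, forall i, t \in `[(0 : R), T] ->
    is_derive t (1 : R) (fun s => x s ord0 i) (h i t).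
  by apply: leb_ae_forall_ord => i; case: (hhP i).
apply: leb_ae_itvcc; have UAx : \forall t \ae leb R, (t \in `[(0 : R), T] ->
  U (u t)) /\
    (t \in `[(0 : R), T] -> is_derive t (1 : R)
      (fun s => \int[leb R]_(r in `[0, s]) (\sum_i A i r * x r ord0 i))
      (\sum_i A i t * x t ord0 i)).
  by move: uU (primitive_is_derive bAx); apply: filterS2.
move: UAx dA dx; apply: filterS3 => t [Ut dAx] {}dA {}dx tT.
have tT' : t \in `[0, T] by move: tT; rewrite !in_itv/= => /andP[? ?]; rewrite !ltW.
have derx : derivable x t 1.
  by apply/derivable_mxP => i j; rewrite (ord1 i); case: (dx j tT').
have xh i : derive1 x t ord0 i = h i t.
  by rewrite derive1E (derive_mx derx) mxE; case: (dx i tT').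
split => //; exists (g t (x t) (u t) - derive1 x t); last by rewrite opprB subrK.
split; first exact: xC.
move=> y Cy.
have -> : dot (g t (x t) (u t) - derive1 x t) (y - x t) = Q y t.
  apply: eq_bigr => i _; rewrite !mxE xh /A driftE//; exact: Ut.
pose F s := \sum_i y ord0 i * (\int[leb R]_(r in `[0, s]) A i r) -
  \int[leb R]_(r in `[0, s]) (\sum_i A i r * x r ord0 i).
have dF : is_derive t (1 : R) F (Q y t).
  have -> : Q y t = \sum_i y ord0 i * A i t - \sum_i A i t * x t ord0 i.
    by rewrite -sumrB; apply: eq_bigr => i _; ring.
  apply: (is_deriveB _ (dAx tT')).
  by apply: is_derive_sumr => i; exact: (is_deriveZ (y ord0 i) (dA i tT')).
move: tT; rewrite in_itv/= => /andP[t0 tT].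
(* The increments of [F] to the right of [t] are integrals of [Q y], which [ineq] makes
   nonpositive. *)
apply: (is_derive_le0 tT dF) => s ts sT; rewrite -subr_le0.
apply: le_trans (ineq y t s Cy (ltW t0) ts sT); rewrite le_eqVlt; apply/orP;
  left; apply/eqP.
have b0s f : bounded_measurable 0 T f -> bounded_measurable 0 s f.
  by move=> bf; exact: bounded_measurableS bf.
have bts f : bounded_measurable 0 T f -> bounded_measurable t s f.
  by move=> bf; apply: bounded_measurableS bf => //; exact: ltW.
have bAi i : bounded_measurable t s (fun r => y ord0 i * A i r).
  by apply: bts; apply: bounded_measurableM => //; exact: bounded_measurable_cst.
transitivity (\sum_i y ord0 i * (\int[leb R]_(r in `[t, s]) A i r) -
  \int[leb R]_(r in `[t, s]) (\sum_i A i r * x r ord0 i)).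
  rewrite /F (Rintegral_itv_split (ltW t0) ts (b0s _ bAx)).
  under eq_bigr do rewrite (Rintegral_itv_split (ltW t0) ts (b0s _ (bA _))) mulrDr.
  by rewrite big_split/=; ring.
have -> : \sum_i y ord0 i * (\int[leb R]_(r in `[t, s]) A i r) =
    \sum_i \int[leb R]_(r in `[t, s]) (y ord0 i * A i r).
  apply: eq_bigr => i _; rewrite RintegralZl//.
  by apply: bounded_measurable_integrable; exact: bts.
rewrite -Rintegral_sum// -RintegralB//.
- by apply: eq_Rintegral => r _; rewrite -sumrB; apply: eq_bigr => i _; ring.
- by apply: bounded_measurable_integrable; exact: bounded_measurable_sum.
- by apply: bounded_measurable_integrable; exact: bts.
Qed.

End limit_process.

(** * Strong convergence of the velocities *)

Section velocity_convergence.
Context {R : realType} {n d : nat}.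
Context (C : set 'rV[R]_n) (U : set 'rV[R]_d) (T M K : R).
Context (g : R -> 'rV[R]_n -> 'rV[R]_d -> 'rV[R]_n).
Context (cC : compact C) (cU : compact U) (T0 : 0 < T) (M0 : 0 <= M).
Context (mg : forall x u, U u -> measurable_on T (fun t => g t x u)).
Context (cg : forall t, t \in `[0, T] ->
  {within [set: 'rV[R]_n] `*` U, continuous (fun p => g t p.1 p.2)}).
Context (gM : forall t x u, t \in `[0, T] -> U u -> enorm (g t x u) <= M).

Let closedC : closed C.
Proof. by apply: compact_closed => //; exact: norm_hausdorff. Qed.

Let closedU : closed U.
Proof. by apply: compact_closed => //; exact: norm_hausdorff. Qed.

(* int |x_k'|^2 = int <g_k, x_k'> tends to int <g, x'> = int |x'|^2, so the weak
   convergence of the velocities is strong in L^2. *)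
Lemma velocity_subseq (x_ : nat -> R -> 'rV[R]_n) (u_ : nat -> R -> 'rV[R]_d)
    (x : R -> 'rV[R]_n) (u : R -> 'rV[R]_d) :
  (forall k, process C U T g (x_ k) (u_ k)) -> process C U T g x u ->
  (forall t i, t \in `[0, T] -> x_ k t ord0 i @[k --> \oo] --> x t ord0 i) ->
  (\forall t \ae leb R, t \in `[(0 : R), T] ->
    forall i, u_ k t ord0 i @[k --> \oo] --> u t ord0 i) ->
  exists s : nat -> nat, (forall k, (k <= s k)%N) /\
    \forall t \ae leb R, t \in `[(0 : R), T] -> forall i,
      derive1 (x_ (s k)) t ord0 i @[k --> \oo] --> derive1 x t ord0 i.
Proof.
move=> pr_ pr x_x u_u.
have facts k := process_velocity closedC T0 M0 gM (pr_ k).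
have lx_ k i : lipschitz M (fun t => x_ k (clamp T t) ord0 i) by case: (facts k).
have xC_ k t : t \in `[0, T] -> C (x_ k t) by case: (facts k) => + _ _; apply.
have [h_ hP_] := choice (fun k => let: And3 _ _ H := facts k in H).
have uU_ k : \forall t \ae leb R, t \in `[(0 : R), T] ->
  U (u_ k t) by case: (pr_ k).
have mu_ k : measurable_on T (u_ k) by case: (pr_ k) => -[].
have mx_ k := lipschitz_measurable_on (lx_ k).
have [xC lx [h [mh hM dh hP]]] := process_velocity closedC T0 M0 gM pr.
have uU : \forall t \ae leb R, t \in `[(0 : R), T] -> U (u t) by case: pr.
have mu : measurable_on T u by case: pr => -[].
have mx := lipschitz_measurable_on lx.
have bG i : bounded_measurable 0 T (drift M g x u i).
  exact (@bounded_measurable_drift R n d C U T M g cC cU M0 mg cg x u i mx mu xC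
    uU).
have bG_ k i : bounded_measurable 0 T (drift M g (x_ k) (u_ k) i).
  exact: (@bounded_measurable_drift R n d C U T M g cC cU M0 mg cg (x_ k) (u_ k)
    i (mx_ k) (mu_ k) (xC_ k) (uU_ k)).
have G_G i := @drift_cvg _ _ _ _ _ _ _ cg gM _ _ _ _ i uU_ uU x_x u_u.
have bh i : bounded_measurable 0 T (h i).
  by split; [apply: borel_lebT_fun => //; exact: measurable_funTS|exists M].
have bh_ k i : bounded_measurable 0 T (h_ k i).
  have [mhk hMk _ _] := hP_ k.
  by split; [apply: borel_lebT_fun => //; exact: measurable_funTS|exists M].
pose phi k t := \sum_i (h_ k i t - h i t) * (h_ k i t - h i t).
have bphi k : bounded_measurable 0 T (phi k).
  by apply: bounded_measurable_sum => i; apply: bounded_measurableM;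
    exact: bounded_measurableB.
have phi0 k t : 0 <= phi k t by apply: sumr_ge0 => i _; rewrite -expr2 sqr_ge0.
pose J (p q : R -> R) := \int[leb R]_(t in `[0, T]) (p t * q t).
have JE (p q r : 'I_n -> R -> R) :
    (forall i, bounded_measurable 0 T (p i)) ->
      (forall i, bounded_measurable 0 T (q i)) ->
    (forall i, bounded_measurable 0 T (r i)) ->
    \int[leb R]_(t in `[0, T]) (\sum_i (p i t * q i t - r i t * q i t - r i t *
      q i t + r i t * r i t)) =
    \sum_i (J (p i) (q i) - J (r i) (q i) - J (r i) (q i) + J (r i) (r i)).
  move=> bp bq br.
  pose pq i := bounded_measurableM (bp i) (bq i).
  pose rq i := bounded_measurableM (br i) (bq i).
  pose rr i := bounded_measurableM (br i) (br i).
  pose b1 i := bounded_measurableB (pq i) (rq i).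
  pose b2 i := bounded_measurableB (b1 i) (rq i).
  rewrite Rintegral_sum; last by move=> i; exact: (bounded_measurableD (b2 i)
    (rr i)).
  apply: eq_bigr => i _.
  rewrite (RintegralD _ (bounded_measurable_integrable (b2 i))
    (bounded_measurable_integrable (rr i)))//.
  rewrite (RintegralB _ (bounded_measurable_integrable (b1 i))
    (bounded_measurable_integrable (rq i)))//.
  by rewrite (RintegralB _ (bounded_measurable_integrable (pq i))
    (bounded_measurable_integrable (rq i))).
have msum (p q r : 'I_n -> R -> R) :
    (forall i, bounded_measurable 0 T (p i)) ->
      (forall i, bounded_measurable 0 T (q i)) ->
    (forall i, bounded_measurable 0 T (r i)) ->
    measurable_fun (`[0, T] : set (lebT R)) (fun t : lebT R =>
      \sum_i (p i t * q i t - r i t * q i t - r i t * q i t + r i t * r i t)).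
  move=> bp bq br.
  pose rq i := bounded_measurableM (br i) (bq i).
  have [] := bounded_measurable_sum (index_enum _) (fun i => bounded_measurableD
    (bounded_measurableB (bounded_measurableB (bounded_measurableM (bp i) (bq i))
      (rq i)) (rq i)) (bounded_measurableM (br i) (br i))).
  by [].
(* The energy identity replaces the term quadratic in [h_ k], on which weak convergence says
   nothing, by the product of the strongly convergent drift with [h_ k]. *)
have phiE k : \int[leb R]_(t in `[0, T]) phi k t =
    \sum_i (J (drift M g (x_ k) (u_ k) i) (h_ k i) - J (h i) (h_ k i) - J (h i)
      (h_ k i) + J (h i) (h i)).
  rewrite -JE//; apply: Rintegral_ae_eq.
  - by case: (bphi k).
  - exact: (msum _ _ _ (bG_ k) (bh_ k) bh).
  - have [_ _ _] := hP_ k; apply: filterS => t H tT; have [Ut _ _ E] := H tT.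
    transitivity (\sum_i h_ k i t * h_ k i t - \sum_i (h i t * h_ k i t + h i t
      * h_ k i t - h i t * h i t)).
      by rewrite -sumrB; apply: eq_bigr => i _; ring.
    rewrite E -sumrB; apply: eq_bigr => i _; rewrite (driftE gM)//; ring.
(* The expected limit is the integral of <g, h> - |h|^2, which vanishes by the energy identity of
   the limit process. *)
have lim0 : \sum_i (J (drift M g x u i) (h i) - J (h i) (h i) - J (h i) (h i) +
  J (h i) (h i)) = 0.
  rewrite -JE//.
  transitivity (\int[leb R]_(t in `[0, T]) 0);
    last by rewrite Rintegral_cst// mul0r.
  apply: Rintegral_ae_eq.
  - exact: (msum _ _ _ bG bh bh).
  - exact: measurable_cst.
  - apply: filterS hP => t H tT; have [Ut _ _ E] := H tT.
    transitivity (\sum_i g t (x t) (u t) ord0 i * h i t - \sum_i h i t * h i t).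
      by rewrite -sumrB; apply: eq_bigr => i _; rewrite (driftE gM)//; ring.
    by rewrite E subrr.
have cphi : \int[leb R]_(t in `[0, T]) phi k t @[k --> \oo] --> (0 : R).
  rewrite -[X in _ --> X]lim0.
  suff H : \sum_i (J (drift M g (x_ k) (u_ k) i) (h_ k i) - J (h i) (h_ k i) - J
    (h i) (h_ k i) + J (h i) (h i)) @[k --> \oo] -->
      \sum_i (J (drift M g x u i) (h i) - J (h i) (h i) - J (h i) (h i) + J (h
        i) (h i)).
    by apply: cvg_trans H; apply: near_eq_cvg; apply: nearW => k;
      exact: (esym (phiE k)).
  apply: cvg_big => [|i _]; first exact: add_continuous.
  have SW (p_ : nat -> R -> R) p : (forall k, bounded_measurable 0 T (p_ k)) ->
      (forall k t, `|p_ k t| <= M) -> bounded_measurable 0 T p ->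
      (\forall t \ae leb R, t \in `[(0 : R), T] -> p_ k t @[k --> \oo] --> p t) ->
      J (p_ k) (h_ k i) @[k --> \oo] --> J p (h i).
    move=> bp_ pM bp p_p.
    apply: (@strong_weak_cvg _ T M M 0 T p_ p (fun k t => x_ k (clamp T t) ord0 i)
      (fun t => x (clamp T t) ord0 i) (fun k => h_ k i)) => //.
    - by move=> k; case: (bp_ k).
    - by move=> t tT; rewrite clampE//; exact: x_x.
    - by move=> k; case: (bh_ k i).
    - by move=> k; case: (hP_ k).
    - by move=> k; case: (hP_ k).
  have cG := SW (fun k => drift M g (x_ k) (u_ k) i) (drift M g x u i)
    (fun k => bG_ k i) (fun k t => @drift_le _ _ _ _ g M0 _ _ i t) (bG i) (G_G i).
  have ch := SW (fun=> h i) (h i) (fun=> bh i) (fun=> hM i) (bh i)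
    (nearW _ (fun t _ => cvg_cst (h i t))).
  apply: cvgD; last exact: cvg_cst.
  by apply: cvgB; [apply: cvgB; [exact: cG|exact: ch]|exact: ch].
have [s [sk cs]] := Rintegral_cvg0_subseq bphi phi0 cphi.
exists s; split => //.
have E_ : \forall t \ae leb R, forall k, t \in `[(0 : R), T] ->
    forall i, derive1 (x_ k) t ord0 i = h_ k i t.
  apply: ae_foralln => k; have [_ _ _] := hP_ k.
  by apply: filterS => t H tT; case: (H tT).
move: hP E_ cs; apply: filterS3 => t hPt Et ct tT i.
have [_ xh _ _] := hPt tT; rewrite xh.
have -> : (fun k => derive1 (x_ (s k)) t ord0 i) = (fun k => h_ (s k) i t).
  by apply/funext => k; rewrite Et.
(* The tolerance is squared because [phi] dominates the square of each coordinate difference. *)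
apply/(@cvgrPdist_lt _ R^o) => e e0; have e2 : 0 < e ^+ 2 by rewrite exprn_gt0.
have := ct tT => /(@cvgrPdist_lt _ R^o)/(_ _ e2); apply: filterS => k.
rewrite sub0r normrN ger0_norm// => H.
rewrite -(@ltr_pXn2r _ 2)// ?nnegrE//; last exact: ltW.
apply: le_lt_trans H; rewrite real_normK ?num_real// -sqrrN opprB expr2.
by rewrite /phi (bigD1 i)//= lerDl; apply: sumr_ge0 => j _; rewrite -expr2 sqr_ge0.
Qed.

End velocity_convergence.

(** * Sequential compactness of the set of processes *)

Section process_compactness.
Context {R : realType}.

Lemma etotal_variation_dist d (T K : R) (u : R -> 'rV[R]_d) (i : 'I_d) s t :
  (etotal_variation 0 T u <= K%:E)%E -> s \in `[0, T] -> t \in `[0, T] ->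
  `|u t ord0 i - u s ord0 i| <= K.
Proof.
move=> tvu; wlog st : s t / s <= t.
  move=> H sT tT; have [st|/ltW ts] := leP s t; first exact: H.
  by rewrite distrC; exact: H.
rewrite !in_itv/= => /andP[s0 sT] /andP[t0 tT].
rewrite -lee_fin; apply: le_trans tvu.
apply: le_trans (total_variation_le_etotal 0 T u i).
apply: (le_trans (total_variation_ge (fun t => u t ord0 i) st)).
rewrite (total_variationD (fun t => u t ord0 i) s0 sT).
rewrite (total_variationD (fun t => u t ord0 i) st tT).
apply: (@le_trans _ _ (total_variation s t (fun t => u t ord0 i) +
  total_variation t T (fun t => u t ord0 i))%E).
  by rewrite leeDl// total_variation_ge0.
by rewrite leeDr// total_variation_ge0.
Qed.

Lemma lipschitz_absolutely_continuous n (T M : R) (x : R -> 'rV[R]_n) : 0 <= M ->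
  (forall i, lipschitz M (fun t => x t ord0 i)) -> absolutely_continuous_on T x.
Proof.
(* The constant [M] is per coordinate, and the Euclidean norm is at most the sum of the [n]
   moduli. *)
move=> M0 lx e e0; pose L := n%:R * M.
have L0 : 0 <= L by rewrite mulr_ge0.
have L1 : 0 < L + 1 by rewrite ltr_wpDl.
exists (e / (L + 1)); first by rewrite divr_gt0.
move=> m a b ab _ sm; apply: (@le_lt_trans _ _ (\sum_(i < m) L * (b i - a i))).
  apply: ler_sum => i _; have [_ abi _] := ab i.
  apply: (le_trans (enorm_le_sum _)).
  apply: (@le_trans _ _ (\sum_(j < n) M * (b i - a i))).
    apply: ler_sum => j _; rewrite !mxE; apply: (le_trans (lx j _ _)).
    by rewrite ger0_norm// subr_ge0.
  by rewrite sumr_const card_ord /L -mulrA mulr_natl.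
rewrite -mulr_sumr; apply: (@le_lt_trans _ _ ((L + 1) * \sum_(i < m) (b i - a i))).
  rewrite ler_wpM2r ?lerDl//; apply: sumr_ge0 => i _.
  by have [_ abi _] := ab i; rewrite subr_ge0.
by rewrite -ltr_pdivlMl// mulrC.
Qed.

Context {n d : nat}.
Context (C : set 'rV[R]_n) (U : set 'rV[R]_d) (T M K : R).
Context (g : R -> 'rV[R]_n -> 'rV[R]_d -> 'rV[R]_n).
Context (cC : compact C) (cU : compact U) (T0 : 0 < T) (M0 : 0 <= M).
Context (mg : forall x u, U u -> measurable_on T (fun t => g t x u)).
Context (cg : forall t, t \in `[0, T] ->
  {within [set: 'rV[R]_n] `*` U, continuous (fun p => g t p.1 p.2)}).
Context (gM : forall t x u, t \in `[0, T] -> U u -> enorm (g t x u) <= M).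

(** Controls, states and velocities are extracted in this order. The last extraction becomes
    possible once the limit is known to be a process, since it relies on the energy identity of the
    limit. *)
Lemma process_compactness (x_ : nat -> R -> 'rV[R]_n) (u_ : nat -> R -> 'rV[R]_d) :
  (forall k, process C U T g (x_ k) (u_ k)) -> (forall k, controls U T K (u_ k)) ->
  exists (x : R -> 'rV[R]_n) (u : R -> 'rV[R]_d) (s : nat -> nat),
    [/\ process C U T g x u, controls U T K u, forall k, (k <= s k)%N &
      \forall t \ae leb R, t \in `[(0 : R), T] ->
        [/\ forall i, x_ (s k) t ord0 i @[k --> \oo] --> x t ord0 i,
          forall i, u_ (s k) t ord0 i @[k --> \oo] --> u t ord0 i &
          forall i, derive1 (x_ (s k)) t ord0 i @[k --> \oo] -->
            derive1 x t ord0 i]].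
Proof.
move=> pr ct.
have closedC : closed C by apply: compact_closed => //; exact: norm_hausdorff.
have closedU : closed U by apply: compact_closed => //; exact: norm_hausdorff.
have tv k : (etotal_variation 0 T (u_ k) <= K%:E)%E by case: (ct k).
have uU_ k : \forall t \ae leb R, t \in `[(0 : R), T] -> U (u_ k t) by case: (pr k).
have [BU HBU] := compact_coord_bounded cU.
have [BC HBC] := compact_coord_bounded cC.
(* A control lies in [U] almost everywhere only, but from one such time the variation bound reaches
   every other, at the cost of [K]. *)
have uB k t i : t \in `[0, T] -> `|u_ k t ord0 i| <= BU + K.
  move=> tT; have [t0 t0T Ut0] := leb_ae_exists T0 (uU_ k).
  rewrite -[u_ k t ord0 i](subrKC (u_ k t0 ord0 i)).
  apply: (le_trans (ler_normD _ _)); apply: lerD; first exact: HBU (Ut0 t0T).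
  exact: etotal_variation_dist (tv k) t0T tT.
have [u [s1 [tvu s1k uB' u1]]] := helly_selection T0 tv uB.
have facts k := process_velocity closedC T0 M0 gM (pr k).
have lx1 k i : lipschitz M (fun t => x_ (s1 k) (clamp T t) ord0 i) by case:
  (facts (s1 k)).
have xB k t i : t \in `[0, T] -> `|x_ (s1 k) t ord0 i| <= BC.
  by move=> tT; apply: HBC; case: (facts (s1 k)) => + _ _; apply.
have [x [s2 [s2k lx xcl x2]]] := lipschitz_selection T0 lx1 xB.
pose s12 := s1 \o s2.
have s2oo : s2 k @[k --> \oo] --> \oo.
  by move=> N [m _ mN]; exists m => // k /= mk; apply: mN => /=;
    exact: leq_trans (s2k k).
have u2 : \forall t \ae leb R, t \in `[(0 : R), T] ->
    forall i, u_ (s12 k) t ord0 i @[k --> \oo] --> u t ord0 i.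
  apply: filterS u1 => t ut tT i.
  exact: (@cvg_comp _ _ _ s2 (fun k => u_ (s1 k) t ord0 i) _ _ _ s2oo (ut tT i)).
have uU : \forall t \ae leb R, t \in `[(0 : R), T] -> U (u t).
  have := ae_foralln uU_; move: u2; apply: filterS2 => t ut Ut tT.
  have cu : u_ (s12 k) t @[k --> \oo] --> u t by apply: cvg_rV => i; exact: ut.
  apply: (@closed_cvg _ _ _ _ (fun k => u_ (s12 k) t) U closedU _ (u t) cu).
  by apply: nearW => k; exact: Ut.
have mu_ k : measurable_on T (u_ k) by case: (pr k) => -[].
have mu : measurable_on T u.
  move=> i; apply: (@ae_cvg_measurable R 0 T (fun k t => u_ (s12 k) t ord0 i)).
    by move=> k; exact: mu_.
  by apply: filterS u2 => t ut tT; exact: ut.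
have bu i : bounded_measurable 0 T (fun t => u t ord0 i).
  by split; [exact: mu|exists (BU + K) => t tT; exact: uB'].
have intu i : (\int[leb R]_(t in `[0%R, T]) (u t ord0 i)%:E = 0)%E.
  have iu := bounded_measurable_integrable (bu i).
  rewrite -[LHS]fineK; last by apply: integrable_fin_num.
  congr EFin.
  have H : \int[leb R]_(t in `[0, T]) (u_ (s12 k) t ord0 i) @[k --> \oo] -->
      \int[leb R]_(t in `[0, T]) (u t ord0 i).
    apply: (@bounded_Rintegral_cvg R 0 T (fun k t => u_ (s12 k) t ord0 i) _ (BU
      + K)).
    - by move=> k; exact: mu_.
    - by move=> k; apply: nearW => t tT; exact: uB.
    - exact: mu.
    - by apply: filterS u2 => t ut tT; exact: ut.
  apply: (cvg_unique (@Rhausdorff R) H).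
  rewrite (_ : (fun k => _) = (fun=> 0)); first exact: cvg_cst.
  by apply/funext => k; rewrite /Rintegral; case: (pr (s12 k)) => _ _ _ -> _.
have dyn := limit_dynamics cC cU T0 M0 mg cg gM (fun k => pr (s12 k)) lx x2 mu
  uU u2.
have in0 : (0 : R) \in `[0, T] by rewrite in_itv/= lexx ltW.
have inT : T \in `[0, T] by rewrite in_itv/= lexx ltW.
have pru : process C U T g x u.
  split => //; first by split => //; exact: lipschitz_absolutely_continuous lx.
  apply/rowP => i.
  apply: (cvg_unique (@Rhausdorff R) (x2 0 i in0)).
  rewrite (_ : (fun k => _) = (fun k => x_ (s1 (s2 k)) T ord0 i)); first exact: x2.
  by apply/funext => k; case: (pr (s12 k)) => _ _ _ _ ->.
have [s3 [s3k v3]] := velocity_subseq cC cU T0 M0 mg cg gM (fun k => pr (s12 k))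
  pru x2 u2.
have s3oo : s3 k @[k --> \oo] --> \oo.
  by move=> N [m _ mN]; exists m => // k /= mk; apply: mN => /=;
    exact: leq_trans (s3k k).
exists x, u, (s12 \o s3); split => //.
- split => //; move=> i; exact: bounded_measurable_integrable (bu i).
- by move=> k /=; apply: leq_trans (s3k k) _; apply: leq_trans (s2k _) _;
  exact: s1k.
move: u2 v3; apply: filterS2 => t ut vt tT; split => i.
- exact: (@cvg_comp _ _ _ s3 (fun k => x_ (s12 k) t ord0 i) _ _ _ s3oo (x2 t i tT)).
- exact: (@cvg_comp _ _ _ s3 (fun k => u_ (s12 k) t ord0 i) _ _ _ s3oo (ut tT i)).
- exact: vt.
Qed.

End process_compactness.

(** * Upper semicontinuity of the cost *)

Section reverse_fatou.
Context {R : realType}.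
Local Open Scope ereal_scope.

Lemma limn_einfE_sup (u : (\bar R)^nat) : limn_einf u = ereal_sup (range (einfs u)).
Proof. by rewrite limn_einf_lim; apply/cvg_lim => //; exact: cvg_einfs_sup. Qed.

Lemma limn_einf_ge (u : (\bar R)^nat) (l : \bar R) :
  (\forall k \near \oo, l <= u k) -> l <= limn_einf u.
Proof.
move=> [N _ HN]; rewrite limn_einfE_sup.
apply: (@le_trans _ _ (einfs u N)); last by apply: ereal_sup_ubound; exists N.
by apply: le_ereal_inf_tmp => _ [k /= Nk <-]; exact: HN.
Qed.

Lemma limn_einf_le (u : (\bar R)^nat) (l : R) :
  (forall k, u k <= (l + k.+1%:R^-1)%:E) -> limn_einf u <= l%:E.
Proof.
move=> ul; rewrite limn_einfE_sup; apply: ge_ereal_sup => _ [n _ <-].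
apply/lee_addgt0Pr => e e0; near \oo => k.
apply: (@le_trans _ _ (u k)).
  by apply: ereal_inf_lbound; exists k => //=; near: k; exact: nbhs_infty_ge.
apply: (le_trans (ul k)); rewrite -EFinD lee_fin lerD2l ltW//.
by near: k; exact: (near_infty_natSinv_lt (PosNum e0)).
Unshelve. all: by end_near. Qed.

Context (a b : R).
Let D : set (lebT R) := `[a, b]%classic.
(** The truncation at 0 makes the gap nonnegative at every point, as Fatou's lemma wants, although
    [f] stays below [m] only almost everywhere. *)
Let gap (m f : R -> R) (t : R) : R := Num.max 0%R (m t - f t)%R.

Let measurable_gap (m f : R -> R) : measurable_fun D (m : lebT R -> R) ->
  measurable_fun D (f : lebT R -> R) -> measurable_fun D (gap m f : lebT R -> R).
Proof.
move=> mm mf; apply: measurable_maxr; first exact: measurable_cst.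
exact: measurable_funB.
Qed.

(** The integral of [f] may be -oo, so only its positive part is compared with the modulus of
    [m]. *)
Lemma integral_le_dominating (m f : R -> R) :
  measurable_fun D (m : lebT R -> R) -> measurable_fun D (f : lebT R -> R) ->
  (\forall t \ae leb R, t \in `[a, b] -> (f t <= m t)%R) ->
  \int[leb R]_(t in D) (f t)%:E <= \int[leb R]_(t in D) `|(m t)%:E|.
Proof.
move=> mm mf fm.
have mD : measurable D by exact: measurable_lebT_itv.
have mEf : measurable_fun D (EFin \o f) by exact/measurable_EFinP.
rewrite integralE; apply: (@le_trans _ _ (\int[leb R]_(t in D) (EFin \o f)^\+ t)).
  by rewrite -[leRHS]sube0 leeB//; apply: integral_ge0.
apply: (@ae_ge0_le_integral _ _ _ (leb R) D mD (EFin \o f)^\+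
  (fun t => `|(EFin \o m) t|)).
- by move=> t _; exact: funepos_ge0.
- exact: measurable_funepos.
- by move=> t _; exact: abse_ge0.
- apply/measurable_EFinP.
  have : measurable_fun D (fun t : lebT R => `|m t|%R) by exact: measurableT_comp.
  by apply/measurable_funS.
- apply: filterS fm => t H tD; rewrite funeposE ge_max/= !lee_fin normr_ge0 andbT.
  by apply: (le_trans (H tD)); exact: ler_norm.
Qed.

Let integral_gap_le (m f : R -> R) (S : R) :
  (leb R).-integrable D (EFin \o m) -> measurable_fun D (f : lebT R -> R) ->
  (\forall t \ae leb R, t \in `[a, b] -> (f t <= m t)%R) ->
  S%:E <= \int[leb R]_(t in D) (f t)%:E ->
  \int[leb R]_(t in D) (gap m f t)%:E <= \int[leb R]_(t in D) (m t)%:E - S%:E.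
Proof.
move=> im mf fm Sf.
have mD : measurable D by exact: measurable_lebT_itv.
have mm : measurable_fun D (m : lebT R -> R).
  by apply/measurable_EFinP; case/integrableP: im.
have mEf : measurable_fun D (EFin \o f) by exact/measurable_EFinP.
(* The bound by [m] excludes the value +oo of the integral and [S] excludes -oo, so [f] is
   integrable and integrals may be subtracted. *)
have if_ : (leb R).-integrable D (EFin \o f).
  apply/integrableP; split => //.
  rewrite [X in X < _](_ : _ = \int[leb R]_(t in D) `|(f t)%:E|)//.
  rewrite integral_fin_num_abs// fin_numE; apply/andP; split.
    by apply/eqP => E; move: Sf; rewrite E.
  rewrite -ltey; apply: le_lt_trans (integral_le_dominating mm mf fm) _.
  by case/integrableP: im.
have -> : \int[leb R]_(t in D) (gap m f t)%:E = \int[leb R]_(t in D) ((m t)%:E -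
  (f t)%:E).
  apply: (@ae_eq_integral _ _ _ (leb R) D (fun t => (m t)%:E - (f t)%:E)
    (EFin \o gap m f) mD).
  - by apply/measurable_EFinP; exact: measurable_gap.
  - by apply: emeasurable_funB; exact/measurable_EFinP.
  - by apply: filterS fm => t H tD; rewrite /= /gap max_r// subr_ge0; exact: H.
by rewrite integralB//; apply: leeB.
Qed.

(** Fatou's lemma applied to the gaps between [m] and the [f_ k]. The last hypothesis says in
    quantifiers that the upper limit of the [f_ k] is at most [f], the form in which upper
    semicontinuity delivers it. *)
Lemma reverse_fatou (f_ : nat -> R -> R) (f m : R -> R) (S : R) :
  (forall k, measurable_fun D (f_ k : lebT R -> R)) ->
  measurable_fun D (f : lebT R -> R) -> (leb R).-integrable D (EFin \o m) ->
  (forall k, \forall t \ae leb R, t \in `[a, b] -> (f_ k t <= m t)%R) ->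
  (\forall t \ae leb R, t \in `[a, b] -> (f t <= m t)%R) ->
  (forall k, (S - k.+1%:R^-1)%:E <= \int[leb R]_(t in D) (f_ k t)%:E) ->
  (\forall t \ae leb R, t \in `[a, b] ->
    forall r, (f t < r)%R -> \forall k \near \oo, (f_ k t < r)%R) ->
  S%:E <= \int[leb R]_(t in D) (f t)%:E.
Proof.
move=> mf_ mf im f_m fm SI usc.
have mD : measurable D by exact: measurable_lebT_itv.
have mm : measurable_fun D (m : lebT R -> R).
  by apply/measurable_EFinP; case/integrableP: im.
pose I := fine (\int[leb R]_(t in D) (m t)%:E).
have IE : \int[leb R]_(t in D) (m t)%:E = I%:E.
  by rewrite /I fineK//; apply: integrable_fin_num.
have mgk k : measurable_fun D (EFin \o gap m (f_ k)).
  by apply/measurable_EFinP; exact: measurable_gap.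
have gap0 h t : 0 <= (gap m h t)%:E by rewrite lee_fin /gap le_max lexx.
have L1 : limn_einf (fun k => \int[leb R]_(t in D) (gap m (f_ k) t)%:E) <= (I -
  S)%:E.
  apply: limn_einf_le => k.
  have := integral_gap_le im (mf_ k) (f_m k) (SI k).
  by rewrite IE -EFinB opprB addrA [X in (X)%:E](_ : _ = I - S +
    k.+1%:R^-1)%R//; ring.
have L2 := fatou (leb R) mD mgk (fun k t _ => gap0 (f_ k) t).
have mliminf : measurable_fun D (fun t => limn_einf (fun k => (gap m (f_ k) t)%:E)).
  apply: (emeasurable_fun_cvg _ _ (measurable_fun_einfs mgk)) => t _.
  by rewrite limn_einf_lim; exact: is_cvg_einfs.
have gapf : \int[leb R]_(t in D) (gap m f t)%:E <= (I - S)%:E.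
  apply: le_trans (le_trans L2 L1).
  apply: (@ae_ge0_le_integral _ _ _ (leb R) D mD (EFin \o gap m f)
    (fun t => limn_einf (fun k => (gap m (f_ k) t)%:E))) => [t _||t _||].
  - exact: gap0.
  - by apply/measurable_EFinP; exact: measurable_gap.
  - by apply: limn_einf_ge; apply: nearW => k; exact: gap0.
  - exact: mliminf.
  (* Once [f_ k t] is below [f t + e], the gap of [f_ k] exceeds that of [f] minus [e]. *)
  - apply: filterS usc => t H tD; apply/lee_subgt0Pr => e e0.
    have := H tD (f t + e)%R; rewrite ltrDl => /(_ e0) near_lt.
    apply: limn_einf_ge; apply: filterS near_lt => k fk.
    rewrite -EFinB lee_fin /gap lerBlDr ge_max addr_ge0 ?le_max ?lexx// ?(ltW
      e0)//=.
    apply: (@le_trans _ _ (m t - f_ k t + e)%R);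
      last by rewrite lerD2r le_max lexx orbT.
    by rewrite -addrA lerD2l; move: fk; lra.
(* The upper bound obtained for the gap of [f] makes it integrable, so [f], equal almost everywhere
   to [m] minus its gap, can be integrated as a difference. *)
have igap : (leb R).-integrable D (EFin \o gap m f).
  apply/integrableP; split; first by apply/measurable_EFinP; exact: measurable_gap.
  have -> : \int[leb R]_(t in D) `|(EFin \o gap m f) t| = \int[leb R]_(t in D)
    (gap m f t)%:E.
    by apply: eq_integral => t _; rewrite gee0_abs//; exact: gap0.
  exact: le_lt_trans gapf (ltry _).
have -> : \int[leb R]_(t in D) (f t)%:E =
    \int[leb R]_(t in D) ((m t)%:E - (gap m f t)%:E).
  apply: (@ae_eq_integral _ _ _ (leb R) D (fun t => (m t)%:E - (gap m f t)%:E)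
    (EFin \o f) mD).
  - exact/measurable_EFinP.
  - by apply: emeasurable_funB; apply/measurable_EFinP => //; exact: measurable_gap.
  - apply: filterS fm => t H tD; rewrite /= /gap max_r ?subr_ge0; last exact: H.
    by rewrite -EFinB subKr.
rewrite integralB// IE.
have -> : \int[leb R]_(t in D) (gap m f t)%:E = (fine (\int[leb R]_(t in D) (gap
  m f t)%:E))%:E.
  by rewrite fineK//; exact: integrable_fin_num.
rewrite -EFinB lee_fin lerBrDl -lerBrDr.
rewrite -lee_fin fineK//; exact: integrable_fin_num.
Qed.

End reverse_fatou.

Lemma usc_cvg (R : realType) (X : topologicalType) (A : set X) (h : X -> R) (p : X)
    (q : nat -> X) (a : R) : upper_semicontinuous_on A h -> A p ->
  (forall k, A (q k)) -> q k @[k --> \oo] --> p -> h p < a ->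
  \forall k \near \oo, h (q k) < a.
Proof.
move=> usc Ap Aq qp /(usc p Ap) H.
by have [N _ HN] := qp _ H; exists N => // k Nk; exact: HN k Nk (Aq k).
Qed.

(** * Existence of a maximizer *)

Unset Implicit Arguments.

Theorem theorem2p1 (R : realType) (n d : nat)
  (C : set 'rV[R]_n) (U : set 'rV[R]_d) (T K : R)
  (g : R -> 'rV[R]_n -> 'rV[R]_d -> 'rV[R]_n)
  (f : R -> 'rV[R]_n -> 'rV[R]_n -> 'rV[R]_d -> R)
  (C_compact : compact C) (C_convex : convex_set C)
  (U_compact : compact U) (T_gt0 : 0 < T) (K_gt0 : 0 < K)
  (g_measurable : forall x u, U u -> measurable_on T (fun t => g t x u))
  (g_continuous : forall t, t \in `[0, T] ->
    {within [set: 'rV[R]_n] `*` U, continuous (fun p => g t p.1 p.2)})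
  (g_bounded : exists M : R, forall t x u, t \in `[0, T] -> U u ->
    enorm (g t x u) <= M)
  (f_measurable : forall x v u, U u ->
    measurable_fun (`[0, T] : set (lebT R)) (fun t : lebT R => f t x v u))
  (f_usc : forall t, t \in `[0, T] ->
    upper_semicontinuous_on ([set: 'rV[R]_n] `*` [set: 'rV[R]_n] `*` U)
      (fun p => f t p.1.1 p.1.2 p.2))
  (f_cost : cost_well_defined C U T K g f)
  (feasible : exists x u, process C U T g x u /\ controls U T K u) :
  exists x u, [/\ process C U T g x u, controls U T K u &
    forall y w, process C U T g y w -> controls U T K w ->
      (cost T f y w <= cost T f x u)%E].
Proof.
have [M' gM'] := g_bounded; pose M := `|M'|.
have M0 : 0 <= M by exact: normr_ge0.
have gM : forall t x u, t \in `[0, T] -> U u -> enorm (g t x u) <= M.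
  by move=> t x u tT Uu; apply: (le_trans (gM' t x u tT Uu)); exact: ler_norm.
have [mf [m im fm]] := f_cost.
have mm : measurable_fun (`[0, T] : set (lebT R)) (m : lebT R -> R).
  by apply/measurable_EFinP; case/integrableP: im.
pose admissible (z : (R -> 'rV[R]_n) * (R -> 'rV[R]_d)) :=
  process C U T g z.1 z.2 /\ controls U T K z.2.
pose costs : set (\bar R) := [set cost T f z.1 z.2 | z in admissible].
have costs_le z : admissible z -> (cost T f z.1 z.2 <= ereal_sup costs)%E.
  by move=> az; apply: (@ereal_sup_ubound R costs); exists z.
have [x0 [u0 [px0 cu0]]] := feasible.
(* If the supremum is -oo, all costs equal -oo and the given process is a maximizer. *)
have [Sny|Sny] := eqVneq (ereal_sup costs) -oo%E.
  exists x0, u0; split => // y w py cw.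
  have := costs_le (y, w) (conj py cw); rewrite Sny leeNy_eq => /eqP/= ->.
  exact: leNye.
(* The common integrable upper bound [m] keeps the supremum below +oo. *)
have Sfin : ereal_sup costs \is a fin_num.
  rewrite fin_numE Sny -ltey.
  apply: (@le_lt_trans _ _ (\int[leb R]_(t in `[0%R, T]) `|(m t)%:E|)%E).
    apply: ge_ereal_sup => _ [[y w] [py cw] <-].
    by apply: integral_le_dominating; [exact: mm|exact: mf|exact: fm].
  by case/integrableP: im.
pose S := fine (ereal_sup costs).
have SE : ereal_sup costs = S%:E by rewrite /S fineK.
have zP k : exists z, admissible z /\ ((S - k.+1%:R^-1)%:E <= cost T f z.1 z.2)%E.
  have k0 : 0 < k.+1%:R^-1 :> R by rewrite invr_gt0.
  have [_ [z az <-] /ltW H] := ub_ereal_sup_adherent k0 Sfin.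
  by exists z; split => //; move: H; rewrite SE -EFinB.
have [z /all_and2[/all_and2[pz cz] Sz]] := choice zP.
have [x [u [s [pxu cu sk lim]]]] :=
  process_compactness C_compact U_compact T_gt0 M0 g_measurable g_continuous gM
    pz cz.
exists x, u; split => // y w py cw.
apply: (le_trans (costs_le (y, w) (conj py cw))); rewrite SE.
apply: (reverse_fatou (f_ := fun k => integrand f (z (s k)).1 (z (s k)).2) _ _ im).
- by move=> k; exact: mf.
- exact: mf.
- by move=> k; exact: fm.
- exact: fm.
(* As [k <= s k], the tolerance at the extracted index is at most 1/(k+1). *)
- move=> k; apply: le_trans (Sz (s k)); rewrite lee_fin lerD2l lerN2.
  by rewrite lef_pV2 ?posrE// ler_nat ltnS.
have Uz : \forall t \ae leb R, forall k, t \in `[(0 : R), T] -> U ((z k).2 t).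
  by apply: ae_foralln => k; case: (pz k).
have Uu : \forall t \ae leb R, t \in `[(0 : R), T] -> U (u t) by case: pxu.
move: Uz Uu lim; apply: filterS3 => t Uz Uu lim tT r fr.
have [cx cu' cv] := lim tT.
apply: (@usc_cvg R _ _ _ (x t, derive1 x t, u t)
  (fun k => ((z (s k)).1 t, derive1 (z (s k)).1 t,
    (z (s k)).2 t)) r (f_usc t tT)) => //.
- by split => //; exact: Uu.
- by move=> k; split => //; exact: Uz.
- have Cx : (z (s k)).1 t @[k --> \oo] --> x t by exact: cvg_rV.
  have Cu : (z (s k)).2 t @[k --> \oo] --> u t by exact: cvg_rV.
  have Cv : derive1 (z (s k)).1 t @[k --> \oo] --> derive1 x t by exact: cvg_rV.
  exact: (cvg_pair (cvg_pair Cx Cv) Cu).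
Qed.
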